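(* Any language $L$ that is linear-space reducible to $L_{KG}$ is verified by a 2ADfA with bounded error $\epsilon$, moreover, the protocol achieves perfect completeness.
   Context: The Knapsack-game language is $L_{KG}=\{ S\, \forall(a_1,b_1)\, \exists(e_1,f_1)\, \cdots \, \forall(a_n,b_n)\, \exists(e_n,f_n) \}$, where $S$ and each $a_i,b_i,e_i,f_i$ are natural numbers given in binary, and for every $x\in \prod_{i=1}^{n}\{a_i,b_i\}$ there exists $y\in \prod_{i=1}^{n}\{e_i,f_i\}$ with $S=\sum_{i=1}^{n}(x_i+y_i)$. An affine state of an $m$-state affine register is a vector $v\in\mathbb{R}^m$ whose entries sum to $1$; affine operators are real matrices whose columns each sum to $1$; weighting observes basis state $e_j$ with probability $|v_j|/\|v\|_1$. A 2ADfA is a two-way deterministic finite automaton on the read-only input $¢ w\$$ (left end-marker ¢, right end-marker \$) equipped with finitely many affine registers (with rational transition matrices), each updated by an affine operator or weighted at each step, with the deterministic state and head move then depending on state, symbol and weighting outcomes; it halts upon entering an accepting or rejecting state. The 2ADfA is the verifier in an Arthur–Merlin proof system (public coins: deterministic states, head moves and weighting outcomes are revealed to the all-powerful prover). Verification with error $\epsilon<1/2$ (rational): some prover makes every $w\in L$ accepted with probability at least $1-\epsilon$, and for every $w\notin L$ and every prover, $w$ is rejected with probability at least $1-\epsilon$. Perfect completeness means every $w\in L$ is accepted with probability $1$. *)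

(* Defs.v *)
(* All probabilities are rational (rational matrices and
   initial vectors), so everything is computed in [rat]. *)
From HB Require Import structures.
From mathcomp Require Import all_boot all_order all_algebra.
Unset Printing Implicit Defensive.
Import Order.TTheory GRing.Theory Num.Theory.

(* Read-only input tape  ¢ w $ : position 0 is ¢, positions 1..|w| hold w,
   position |w|+1 is $.                                                 *)
Inductive tsym (S : Type) := LEnd | REnd | Sym of S.
Arguments LEnd {S}. Arguments REnd {S}. Arguments Sym {S}.

Definition tape_at {S : Type} (w : seq S) (i : nat) : tsym S :=
  match i with
  | 0 => LEnd
  | i'.+1 => match drop i' w with x :: _ => Sym x | [::] => REnd end
  end.

Inductive move := MLeft | MStay | MRight.

(* head move on the input tape ¢w$ (positions 0 .. bound); the head never
   leaves the end-markers *)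
Definition move_in (bound : nat) (m : move) (p : nat) : nat :=
  match m with MLeft => p.-1 | MStay => p | MRight => minn p.+1 bound end.

Definition move_work (m : move) (p : nat) : nat :=
  match m with MLeft => p.-1 | MStay => p | MRight => p.+1 end.

Inductive kgsym := K0 | K1 | KAll | KEx | KLp | KRp | KComma.

Definition bits (s : seq bool) : seq kgsym := map (fun b : bool => if b then K1 else K0) s.
(* most significant bit first *)
Definition bitval (s : seq bool) : nat := foldl (fun a (b : bool) => (a.*2 + b)%N) 0%N s.

Definition enc_block (blk : seq bool * seq bool * seq bool * seq bool) : seq kgsym :=
  let: (a, b, e, f) := blk in
  KAll :: KLp :: bits a ++ KComma :: bits b ++ KRp ::
  KEx :: KLp :: bits e ++ KComma :: bits f ++ [:: KRp].

Definition enc_KG (S : seq bool) (blks : seq (seq bool * seq bool * seq bool * seq bool)) :=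
  bits S ++ flatten (map enc_block blks).

(* for every x in prod {a_i,b_i} there is y in prod {e_i,f_i} with
   S = sum_i (x_i + y_i); x (resp. y) is given by a choice vector of bools *)
Definition KG_game (S : nat) (q : seq (nat * nat * nat * nat)) : Prop :=
  forall x : seq bool, size x = size q ->
  exists y : seq bool, size y = size q /\
    S = (\sum_(i < size q)
           let: (a, b, e, f) := nth (0, 0, 0, 0)%N q i in
           ((if nth false x i then b else a) + (if nth false y i then f else e)))%N.

Definition LKG (w : seq kgsym) : Prop :=
  exists (S : seq bool) (blks : seq (seq bool * seq bool * seq bool * seq bool)),
    S != [::] /\
    all (fun blk : seq bool * seq bool * seq bool * seq bool =>
           let: (a, b, e, f) := blk in
           [&& a != [::], b != [::], e != [::] & f != [::]]) blks /\
    w = enc_KG S blks /\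
    KG_game (bitval S)
      (map (fun blk : seq bool * seq bool * seq bool * seq bool =>
              let: (a, b, e, f) := blk in (bitval a, bitval b, bitval e, bitval f)) blks).

(* Linear-space reductions: deterministic Turing transducers with a
   read-only two-way input tape ¢w$, one work tape, and a write-only
   one-way output tape.                                                 *)
Record lstm (S D : Type) := LSTM {
  mQ : finType;
  mG : finType;
  mblank : mG;
  mq0 : mQ;
  mhalt : pred mQ;
  (* state, input symbol, work symbol  |->
     new state, written work symbol, input move, work move, output symbol *)
  mdelta : mQ -> tsym S -> mG -> mQ * mG * move * move * option D;
  mc : nat
}.

Arguments mQ {S D}. Arguments mG {S D}. Arguments mblank {S D}. Arguments mq0 {S D}.
Arguments mhalt {S D}. Arguments mdelta {S D}. Arguments mc {S D}.

Record tmconf (S D : Type) (M : lstm S D) := TMConf {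
  cq : mQ M; cip : nat; ctape : nat -> mG M; cwp : nat; cout : seq D }.

Arguments TMConf {S D M}. Arguments cq {S D M}. Arguments cip {S D M}.
Arguments ctape {S D M}. Arguments cwp {S D M}. Arguments cout {S D M}.

Definition tm_init (S D : Type) (M : lstm S D) : tmconf S D M :=
  TMConf (mq0 M) 0 (fun _ => mblank M) 0 [::].

Definition tm_step (S D : Type) (M : lstm S D) (w : seq S) (c : tmconf S D M) : tmconf S D M :=
  if mhalt M (cq c) then c else
  let: (q', a, mi, mw, od) := mdelta M (cq c) (tape_at w (cip c)) (ctape c (cwp c)) in
  TMConf q' (move_in (size w).+1 mi (cip c))
    (fun i => if i == cwp c then a else ctape c i)
    (move_work mw (cwp c))
    (cout c ++ (if od is Some d then [:: d] else [::])).

Definition tm_run (S D : Type) (M : lstm S D) (w : seq S) (t : nat) : tmconf S D M :=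
  iter t (tm_step S D M w) (tm_init S D M).

Definition computes_linspace (S D : Type) (M : lstm S D) (f : seq S -> seq D) : Prop :=
  forall w : seq S,
    (exists T, mhalt M (cq (tm_run S D M w T)) /\ cout (tm_run S D M w T) = f w) /\
    (forall t, (cwp (tm_run S D M w t) < mc M * (size w).+1)%N).

Definition lin_space_reducible {S D : Type} (L : seq S -> Prop) (L' : seq D -> Prop) : Prop :=
  exists (M : lstm S D) (f : seq S -> seq D),
    computes_linspace S D M f /\ forall w, L w <-> L' (f w).

Local Open Scope ring_scope.

Record verifier (S : finType) := Verifier {
  vQ : finType;
  vG : finType;                       (* prover-to-verifier communication alphabet *)
  vr : nat;                           (* number of affine registers *)
  vdim : 'I_vr -> nat;
  vinit : forall k : 'I_vr, 'cV[rat]_(vdim k);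
  vq0 : vQ;
  vacc : pred vQ;
  vrej : pred vQ;
  (* for each register: Some M = apply affine operator M, None = weighting *)
  vop : vQ -> tsym S -> vG -> forall k : 'I_vr, option 'M[rat]_(vdim k);
  (* next state and head move, depending on the weighting outcomes
     (outcome of register k: Some j if weighted with result e_j, else None) *)
  vtr : vQ -> tsym S -> vG -> ('I_vr -> option nat) -> vQ * move
}.

Arguments vQ {S}. Arguments vG {S}. Arguments vr {S}. Arguments vdim {S}.
Arguments vinit {S}. Arguments vq0 {S}. Arguments vacc {S}. Arguments vrej {S}.
Arguments vop {S}. Arguments vtr {S}.

Definition affine_vec (n : nat) (v : 'cV[rat]_n) : bool := \sum_i v i 0 == 1.
Definition affine_op (n : nat) (M : 'M[rat]_n) : bool := [forall j, \sum_i M i j == 1].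

Definition wf_verifier (S : finType) (V : verifier S) : Prop :=
  (forall k, affine_vec _ (vinit V k)) /\
  (forall q s g k M, vop V q s g k = Some M -> affine_op _ M) /\
  (forall q, ~~ (vacc V q && vrej V q)).

Definition outcome {S : finType} (V : verifier S) := 'I_(vr V) -> option nat.

(* all-powerful prover: sees the whole history (its messages and all
   weighting outcomes, from which states and head moves are determined) *)
Definition prover {S : finType} (V : verifier S) :=
  seq (vG V * outcome V) -> vG V.

Definition wprob (n : nat) (v : 'cV[rat]_n) (j : nat) : rat :=
  (\sum_(i < n | val i == j) `|v i 0|) / (\sum_(i < n) `|v i 0|).

Definition basis (n : nat) (j : nat) : 'cV[rat]_n := \col_(i < n) ((val i == j)%:R).

Definition upd (I : eqType) (T : Type) (f : I -> T) (k : I) (x : T) : I -> T :=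
  fun k' => if k' == k then x else f k'.

Definition outcomes (S : finType) (V : verifier S)
    (regs : forall k, 'cV[rat]_(vdim V k)) (ops : forall k, option 'M[rat]_(vdim V k))
    : seq (rat * outcome V) :=
  foldr (fun k acc =>
           if ops k is None then
             flatten [seq [seq (po.1 * wprob _ (regs k) j, upd _ _ po.2 k (Some j))
                          | j <- iota 0 (vdim V k)] | po <- acc]
           else acc)
        [:: (1, fun _ => None)] (enum 'I_(vr V)).

Definition new_regs (S : finType) (V : verifier S)
    (regs : forall k, 'cV[rat]_(vdim V k)) (ops : forall k, option 'M[rat]_(vdim V k))
    (o : outcome V) : forall k, 'cV[rat]_(vdim V k) :=
  fun k => match ops k with Some M => M *m regs k | None => basis _ (odflt 0%N (o k)) end.

Fixpoint hprob (S : finType) (V : verifier S) (w : seq S) (P : prover V)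
    (target : pred (vQ V)) (t : nat) (q : vQ V) (pos : nat)
    (regs : forall k, 'cV[rat]_(vdim V k)) (hist : seq (vG V * outcome V)) {struct t} : rat :=
  if vacc V q || vrej V q then (target q)%:R else
  match t with
  | 0 => 0
  | t'.+1 =>
      let s := tape_at w pos in
      let g := P hist in
      let ops := vop V q s g in
      \sum_(po <- outcomes S V regs ops)
        po.1 * hprob S V w P target t' (vtr V q s g po.2).1
                 (move_in (size w).+1 (vtr V q s g po.2).2 pos)
                 (new_regs S V regs ops po.2) (rcons hist (g, po.2))
  end.

(* the probability of halting in [target] (the limit of hprob as t grows)
   is at least p *)
Definition halt_prob_ge (S : finType) (V : verifier S) (w : seq S) (P : prover V)
    (target : pred (vQ V)) (p : rat) : Prop :=
  forall d : rat, 0 < d ->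
    exists t, p - d <= hprob S V w P target t (vq0 V) 0 (vinit V) [::].

Definition verifies {S : finType} (V : verifier S) (L : seq S -> Prop) (eps : rat) : Prop :=
  wf_verifier S V /\
  (forall w, L w -> exists P : prover V, halt_prob_ge S V w P (vacc V) (1 - eps)) /\
  (forall w, ~ L w -> forall P : prover V, halt_prob_ge S V w P (vrej V) (1 - eps)).

Definition perfect_completeness {S : finType} (V : verifier S) (L : seq S -> Prop) : Prop :=
  forall w, L w -> exists P : prover V, halt_prob_ge S V w P (vacc V) 1.

(* Main.v *)
From Stdlib Require Import Classical ClassicalEpsilon FunctionalExtensionality.
Require Import Defs.
From HB Require Import structures.
From mathcomp Require Import all_boot all_order all_algebra.
From mathcomp Require Import ring lra zify.

(* The verifier works in rounds, in which it makes two passes over the output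
   of the reduction, simulating the Turing machine with the help of the prover.
   A configuration is a word aligned with the input tape; its base-[b] value is
   held in an affine register.  At every step the prover spells out the current
   configuration; the verifier compares its value with the one predicted by the
   previous step, while predicting the next value, which is linear in the
   letters once the scanned symbols are known.  The comparison puts
   (D / eps, - D / eps, 1) in a register, where D is the difference: observing
   the last basis state is certain if D = 0 and has probability at most eps / 2
   if D is a nonzero integer.

   In the first pass coins choose x, in the second one the prover chooses y, and
   S - sum x - sum y is tested against 0 in the same way.  If the test succeeds,
   the verifier accepts only with a probability exponentially small in the
   number of coins, and otherwise starts a new round.  If w is not in L, some x
   is bad and is drawn with a probability larger than that of acceptance by a
   factor of order 1 / eps, so that each round increases the guaranteed
   probability of rejection by a fixed amount as long as it is below 1 - eps. *)

Set Implicit Arguments.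
Unset Strict Implicit.
Unset Printing Implicit Defensive.
Import Order.TTheory GRing.Theory Num.Theory.
Local Open Scope ring_scope.

(** * Programs over registers with two free coordinates *)

Record aff := Aff { a11 : rat; a12 : rat; a21 : rat; a22 : rat; b1 : rat; b2 : rat }.

Definition aff_app (f : aff) (p : rat * rat) : rat * rat :=
  (a11 f * p.1 + a12 f * p.2 + b1 f, a21 f * p.1 + a22 f * p.2 + b2 f).

Definition aff_id := Aff 1 0 0 1 0 0.

Definition aff_const (x y : rat) := Aff 0 0 0 0 x y.

Lemma aff_app_id p : aff_app aff_id p = p.
Proof. by case: p => x y; rewrite /aff_app /=; congr pair; ring. Qed.

Lemma aff_app_const x y p : aff_app (aff_const x y) p = (x, y).
Proof. by rewrite /aff_app /=; congr pair; ring. Qed.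

Definition aff_vec (p : rat * rat) : 'cV[rat]_3 :=
  \col_i nth 0 [:: p.1; p.2; 1 - p.1 - p.2] i.

(* As the coordinates of a register sum to 1, the translation part of [f] can
   be added to every column. *)
Definition aff_mx (f : aff) : 'M[rat]_3 :=
  \matrix_(i, j)
    let u := nth 0 [:: a11 f; a12 f; 0] j + b1 f in
    let v := nth 0 [:: a21 f; a22 f; 0] j + b2 f in
    nth 0 [:: u; v; 1 - u - v] i.

Lemma affine_aff_vec p : affine_vec 3 (aff_vec p).
Proof. by apply/eqP; rewrite !big_ord_recl big_ord0 !mxE /=; ring. Qed.

Lemma affine_op_aff_mx f : affine_op 3 (aff_mx f).
Proof. by apply/forallP=> j; apply/eqP; rewrite !big_ord_recl big_ord0 !mxE /=; ring. Qed.

Lemma mul_aff_mx f p : aff_mx f *m aff_vec p = aff_vec (aff_app f p).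
Proof.
apply/colP=> i; rewrite !mxE !big_ord_recl big_ord0 !mxE /=.
by case: i => -[|[|[|//]]] /= _; ring.
Qed.

(** The free coordinates of the basis state [e_j]. Both vanish for [j = 2], so a positive
    observation leaves a register at [(0, 0)]. *)
Definition payload (j : nat) : rat * rat := ((j == 0%N)%:R, (j == 1%N)%:R).

Lemma basis_payload j : (j < 3)%N -> basis 3 j = aff_vec (payload j).
Proof.
move=> lt_j; apply/colP=> i; rewrite !mxE /payload.
by case: i => -[|[|[|//]]] ?; case: j lt_j => [|[|[|//]]] _ //=; rewrite ?subr0 ?subrr ?sub0r.
Qed.

(** Probability that weighting a register with free coordinates [p] shows its last basis state. *)
Definition pyes (p : rat * rat) : rat :=
  `|1 - p.1 - p.2| / (`|p.1| + `|p.2| + `|1 - p.1 - p.2|).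

Lemma norm3_gt0 (p : rat * rat) : 0 < `|p.1| + `|p.2| + `|1 - p.1 - p.2|.
Proof.
case: p => x y /=; apply: lt_le_trans (_ : 0 < `|x + y + (1 - x - y)|) _; last first.
  by apply: le_trans (ler_normD _ _) _; rewrite lerD2r ler_normD.
by rewrite (_ : x + y + _ = 1) ?normr1 //; ring.
Qed.

Lemma wprob_aff p j : wprob 3 (aff_vec p) j =
  (if (j < 3)%N then `|nth 0 [:: p.1; p.2; 1 - p.1 - p.2] j| else 0)
   / (`|p.1| + `|p.2| + `|1 - p.1 - p.2|).
Proof.
rewrite /wprob; congr (_ / _); last by rewrite !big_ord_recl big_ord0 !mxE /= addr0 addrA.
rewrite big_mkcond /= !big_ord_recl big_ord0 !mxE /=.
by case: j => [|[|[|j]]] //=; rewrite ?addr0 ?add0r.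
Qed.

Lemma wprob_yes p : wprob 3 (aff_vec p) 2 = pyes p.
Proof. by rewrite wprob_aff. Qed.

Lemma wprob_sum p : wprob 3 (aff_vec p) 0 + wprob 3 (aff_vec p) 1 = 1 - pyes p.
Proof.
rewrite !wprob_aff /pyes /=; have := norm3_gt0 p; set N := _ + _ + _ => N0.
rewrite -mulrDl; apply: (@mulIf _ N); first by rewrite gt_eqF.
by rewrite mulrBl !mulfVK ?gt_eqF // mul1r /N; ring.
Qed.

Lemma wprob_ge0 n v j : 0 <= wprob n v j.
Proof. by rewrite /wprob divr_ge0 // sumr_ge0. Qed.

Lemma pyes_ge0 p : 0 <= pyes p.
Proof. by rewrite -wprob_yes wprob_ge0. Qed.

Lemma pyes_le1 p : pyes p <= 1.
Proof. by have := wprob_sum p; have := wprob_ge0 (aff_vec p) 0; have := wprob_ge0 (aff_vec p) 1; lra. Qed.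

(** With opposite free coordinates the last coordinate is 1. The equality tests and the lottery have
    this form: the observation is certain for [x = 0] and becomes rare as [x] grows. *)
Lemma pyes_opp x : pyes (x, - x) = (1 + 2 * `|x|)^-1.
Proof. by rewrite /pyes /= normrN opprK addrNK normr1 mul1r; congr _^-1; ring. Qed.

(** The rationals are archimedean, so finitely many gains reach the target. This bounds the number
    of rounds, for soundness as well as for completeness. *)
Lemma climb (A : rat -> Prop) (gain target : rat) : 0 < gain -> A 0 ->
  (forall v, A v -> 0 <= v -> v < target -> A (v + gain)) -> exists2 v, target <= v & A v.
Proof.
move=> gain0 A0 step.
have main n : (exists2 v, target <= v & A v) \/ A (gain *+ n).
  elim: n => [|n [?|An]]; [by right|by left|].
  case: (lerP target (gain *+ n)) => [le_t|lt_t]; first by left; exists (gain *+ n).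
  by right; rewrite mulrSr; apply: step; rewrite ?mulrn_wge0 // ltW.
have le_n : target <= gain *+ Num.bound `|target / gain|.
  rewrite -mulr_natl -ler_pdivrMr //; apply: le_trans (ler_norm _) _.
  by apply/ltW/archi_boundP/normr_ge0.
by have [] // := main (Num.bound `|target / gain|) => ?; exists (gain *+ Num.bound `|target / gain|).
Qed.

Section Program.
Variables (S Q G : finType) (r : nat) (q0 : Q) (acc rej : pred Q).
Hypothesis acc_rej : forall q, ~~ (acc q && rej q).

(* [Weigh k qy qn] continues in [qy] when the last basis state of register [k]
   is observed, and in [qn] otherwise. *)
Inductive instr := Op of ('I_r -> aff) & Q & move | Weigh of 'I_r & Q & Q.

Variable prog : Q -> tsym S -> G -> instr.

Definition prog_verifier : verifier S :=
  @Verifier S Q G r (fun _ => 3) (fun _ => aff_vec (0, 0)) q0 acc rej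
    (fun q s g k => match prog q s g with
                    | Op f _ _ => Some (aff_mx (f k))
                    | Weigh k0 _ _ => if k == k0 then None else Some (aff_mx aff_id)
                    end)
    (fun q s g o => match prog q s g with
                    | Op _ q' m => (q', m)
                    | Weigh k qy qn => (if o k == Some 2 then qy else qn, MStay)
                    end).

Local Notation V := prog_verifier.

Lemma wf_prog_verifier : wf_verifier S V.
Proof.
split; first by move=> k; exact: affine_aff_vec.
split; last by move=> q; exact: acc_rej.
move=> q s g k M /=; case: (prog q s g) => [f ? ?|k0 ? ?]; first by case=> <-; exact: affine_op_aff_mx.
by case: (k == k0) => // -[<-]; exact: affine_op_aff_mx.
Qed.

Record conf := Conf { st : Q; hd : nat; rg : 'I_r -> rat * rat }.

Definition setreg (z : 'I_r -> rat * rat) (k : 'I_r) (p : rat * rat) : 'I_r -> rat * rat :=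
  fun k' => if k' == k then p else z k'.

Definition regs (z : 'I_r -> rat * rat) : forall k : 'I_(vr V), 'cV[rat]_(vdim V k) :=
  fun k => aff_vec (z k).

Section Word.
Variable w : seq S.

Definition ops_of c g := vop V (st c) (tape_at w (hd c)) g.

Definition next c (g : G) (o : outcome V) : conf :=
  let s := tape_at w (hd c) in
  Conf (vtr V (st c) s g o).1 (move_in (size w).+1 (vtr V (st c) s g o).2 (hd c))
    (match prog (st c) s g with
     | Op f _ _ => fun k => aff_app (f k) (rg c k)
     | Weigh k _ _ => setreg (rg c) k (payload (odflt 0%N (o k)))
     end).

Definition hp (P : prover V) (target : pred Q) t c hist : rat :=
  hprob S V w P target t (st c) (hd c) (regs (rg c)) hist.

Definition weighed (k : 'I_r) (j : nat) : outcome V := upd _ _ (fun _ => None) k (Some j).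

Lemma outcomes_op c g f q' m : prog (st c) (tape_at w (hd c)) g = Op f q' m ->
  outcomes S V (regs (rg c)) (ops_of c g) = [:: (1, fun _ => None)].
Proof.
move=> E; rewrite /outcomes /ops_of /= E.
by elim: (enum _) => //= k l ->.
Qed.

Lemma outcomes_weigh c g k qy qn : prog (st c) (tape_at w (hd c)) g = Weigh k qy qn ->
  outcomes S V (regs (rg c)) (ops_of c g) =
  [seq (1 * wprob 3 (aff_vec (rg c k)) j, weighed k j) | j <- iota 0 3].
Proof.
move=> E; rewrite /outcomes /ops_of /= E.
have : k \in enum 'I_r by rewrite mem_enum.
have := enum_uniq 'I_r; elim: (enum _) => //= k' l IH /andP[k'l ul].
rewrite in_cons eq_sym; case: eqP => [Ek _|_ /= kl]; last by rewrite IH.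
rewrite {k'}Ek in k'l *.
(* The registers listed after [k] differ from it, so none of them is weighed and they contribute the
   trivial outcome. *)
rewrite (_ : foldr _ _ _ = [:: (1, fun _ => None)]) //=.
by elim: l k'l {IH ul} => //= k1 l IH; rewrite in_cons eq_sym negb_or => /andP[/negPf -> /IH ->].
Qed.

(** The bound on the outcomes matters: for [j >= 3] the vector [basis 3 j] is zero, hence not an
    affine state. *)
Lemma new_regs_next c g o : (forall k j, o k = Some j -> j < 3)%N ->
  new_regs S V (regs (rg c)) (ops_of c g) o = regs (rg (next c g o)).
Proof.
move=> lt_o; apply: functional_extensionality_dep => k.
rewrite /new_regs /ops_of /regs /=.
case: (prog _ _ _) => [f q' m|k0 qy qn]; first exact: mul_aff_mx.
rewrite /setreg; case: eqP => [->|_]; last by rewrite mul_aff_mx aff_app_id.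
by rewrite basis_payload //; case E: (o k0) => [j|] //=; exact: lt_o E.
Qed.

Lemma hp_halted P target t c hist : acc (st c) || rej (st c) ->
  hp P target t c hist = (target (st c))%:R.
Proof. by move=> H; rewrite /hp; case: t => [|t] /=; rewrite H. Qed.

Lemma hp_op P target t c hist f q' m :
  ~~ (acc (st c) || rej (st c)) -> prog (st c) (tape_at w (hd c)) (P hist) = Op f q' m ->
  hp P target t.+1 c hist =
  hp P target t (next c (P hist) (fun _ => None)) (rcons hist (P hist, fun _ => None)).
Proof.
move=> /negPf H E; rewrite /hp /= H.
rewrite -/(ops_of c (P hist)) (outcomes_op E) big_seq1 /= mul1r new_regs_next //.
Qed.

Lemma hp_weigh P target t c hist k qy qn :
  ~~ (acc (st c) || rej (st c)) -> prog (st c) (tape_at w (hd c)) (P hist) = Weigh k qy qn ->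
  hp P target t.+1 c hist = \sum_(j <- iota 0 3) wprob 3 (aff_vec (rg c k)) j *
    hp P target t (next c (P hist) (weighed k j)) (rcons hist (P hist, weighed k j)).
Proof.
move=> /negPf H E; rewrite {1}/hp /= H.
rewrite -/(ops_of c (P hist)) (outcomes_weigh E) big_map.
apply: eq_big_seq => j; rewrite mem_iota /= => lt_j.
rewrite mul1r new_regs_next // => k' j'; rewrite /weighed /upd.
by case: eqP => // _ [<-].
Qed.

Lemma hp_ge0 P target t c hist : 0 <= hp P target t c hist.
Proof.
elim: t c hist => [|t IH] c hist.
  by rewrite /hp /=; case: ifP => // _; rewrite ler0n.
have [H|H] := boolP (acc (st c) || rej (st c)); first by rewrite hp_halted // ler0n.
case E: (prog (st c) (tape_at w (hd c)) (P hist)) => [f q' m|k qy qn].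
  by rewrite (hp_op _ _ H E).
by rewrite (hp_weigh _ _ H E) sumr_ge0 // => j _; rewrite mulr_ge0 ?wprob_ge0.
Qed.

Lemma hp_leS P target t c hist : hp P target t c hist <= hp P target t.+1 c hist.
Proof.
elim: t c hist => [|t IH] c hist.
all: have [H|H] := boolP (acc (st c) || rej (st c)); first by rewrite !hp_halted.
  by rewrite {1}/hp /= (negPf H) hp_ge0.
case E: (prog (st c) (tape_at w (hd c)) (P hist)) => [f q' m|k qy qn].
  by rewrite !(hp_op _ _ H E).
by rewrite !(hp_weigh _ _ H E) ler_sum // => j _; rewrite ler_wpM2l ?wprob_ge0.
Qed.

Lemma hp_mono P target t t' c hist : (t <= t')%N -> hp P target t c hist <= hp P target t' c hist.
Proof.
move=> /subnKC <-; elim: (t' - t)%N => [|d IH]; first by rewrite addn0.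
by rewrite addnS; apply: le_trans (hp_leS _ _ _ _ _).
Qed.

(** * Rejection probabilities guaranteed against every prover *)

Definition guar c (b : rat) := exists t, forall P hist, b <= hp P rej t c hist.

Lemma guar_le c b b' : b <= b' -> guar c b' -> guar c b.
Proof. by move=> lb [t H]; exists t => P hist; apply: le_trans lb (H _ _). Qed.

Lemma guar0 c b : b <= 0 -> guar c b.
Proof. by move=> b0; exists 0%N => P hist; apply: le_trans b0 (hp_ge0 _ _ _ _ _). Qed.

Lemma guar_rej c b : rej (st c) -> b <= 1 -> guar c b.
Proof. by move=> rc b1; exists 0%N => P hist; rewrite hp_halted ?rc ?orbT. Qed.

(** As there are finitely many messages, one time bound serves them all; this is why [guar] can fix
    its bound before the prover. *)
Lemma finite_bound (I : finType) (A : I -> nat -> Prop) :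
  (forall i t t', (t <= t')%N -> A i t -> A i t') ->
  (forall i, exists t, A i t) -> exists t, forall i, A i t.
Proof.
move=> mA exA; suff [t H]: exists t, forall i, i \in enum I -> A i t.
  by exists t => i; apply: H; rewrite mem_enum.
elim: (enum I) => [|i l [t H]]; first by exists 0%N.
have [t' H'] := exA i; exists (maxn t t') => j; rewrite in_cons => /orP[/eqP ->|/H].
  by apply: mA H'; rewrite leq_maxr.
by apply: mA; rewrite leq_maxl.
Qed.

(** Outcomes 0 and 1 lead to the same control state and their probabilities add up to [1 - pyes],
    hence a common bound [bn]. *)
Lemma guar_step c b : ~~ (acc (st c) || rej (st c)) ->
  (forall g, match prog (st c) (tape_at w (hd c)) g with
   | Op f q' m => guar (Conf q' (move_in (size w).+1 m (hd c)) (fun k => aff_app (f k) (rg c k))) b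
   | Weigh k qy qn => exists by_ bn, [/\ guar (Conf qy (hd c) (setreg (rg c) k (0, 0))) by_,
       forall j, (j < 2)%N -> guar (Conf qn (hd c) (setreg (rg c) k (payload j))) bn
     & b <= pyes (rg c k) * by_ + (1 - pyes (rg c k)) * bn] end) -> guar c b.
Proof.
move=> H A.
suff [t Ht] : exists t, forall g, forall P hist, P hist = g -> b <= hp P rej t c hist.
  by exists t => P hist; apply: Ht.
apply: (@finite_bound G (fun g t => forall P hist, P hist = g -> b <= hp P rej t c hist)).
  by move=> g t t' /hp_mono m Ht P hist /Ht E; apply: le_trans E (m _ _ _ _).
move=> g; move: (A g); case E: (prog _ _ _) => [f q' m|k qy qn].
  case=> t Ht; exists t.+1 => P hist Pg.
  by rewrite -Pg in E; rewrite (hp_op _ _ H E); move: (Ht P (rcons hist (P hist, fun=> None)));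
    rewrite /next /= E.
case=> by_ [bn [[t0 H0] /[dup] /(_ 0%N isT)[t1 H1] /(_ 1%N isT)[t2 H2] Hb]].
exists (maxn t0 (maxn t1 t2)).+1 => P hist Pg; rewrite -Pg in E; rewrite (hp_weigh _ _ H E) /=.
rewrite !big_cons big_nil /= addr0 wprob_yes /next /= E /weighed /upd /= !eqxx /=.
have nxt j : payload j = (0,0) -> Conf qy (hd c) (setreg (rg c) k (payload j)) =
   Conf qy (hd c) (setreg (rg c) k (0,0)) by move=> ->.
rewrite (nxt 2%N) //.
set T := maxn _ _.
have := le_trans (H0 P _) (hp_mono P rej _ (rcons hist (P hist, weighed k 2)) (leq_maxl _ _ : (t0 <= T)%N)).
have l1 : (t1 <= T)%N by rewrite !leq_max leqnn orbT.
have l2 : (t2 <= T)%N by rewrite !leq_max leqnn !orbT.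
have := le_trans (H1 P _) (hp_mono P rej _ (rcons hist (P hist, weighed k 0)) l1).
have := le_trans (H2 P _) (hp_mono P rej _ (rcons hist (P hist, weighed k 1)) l2).
rewrite /weighed /upd.
move=> A2 A1 A0; apply: le_trans Hb _; rewrite -wprob_sum mulrDl [leLHS]addrC [leRHS]addrA.
by apply: lerD; [apply: lerD|]; apply: ler_wpM2l => //; rewrite ?wprob_ge0 ?pyes_ge0.
Qed.

Lemma next_op c g f q' m o : prog (st c) (tape_at w (hd c)) g = Op f q' m ->
  next c g o = Conf q' (move_in (size w).+1 m (hd c)) (fun k => aff_app (f k) (rg c k)).
Proof. by move=> E; rewrite /next /= E. Qed.

Lemma next_weigh c g k qy qn j : prog (st c) (tape_at w (hd c)) g = Weigh k qy qn ->
  next c g (weighed k j) =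
  Conf (if j == 2 then qy else qn) (hd c) (setreg (rg c) k (payload j)).
Proof. by move=> E; rewrite /next /= E /weighed /upd eqxx. Qed.

(** * Prover strategies that lead to acceptance with probability 1 *)

Section Honest.
Variable fin : conf -> Prop.

(** The negative branch is constrained only if it has positive probability: a test passed with
    certainty needs no continuation after failure. *)
Definition safe_step (W : conf -> Prop) c g : Prop :=
  match prog (st c) (tape_at w (hd c)) g with
  | Op f q' m => W (Conf q' (move_in (size w).+1 m (hd c)) (fun k => aff_app (f k) (rg c k)))
  | Weigh k qy qn => W (Conf qy (hd c) (setreg (rg c) k (0, 0))) /\
      (pyes (rg c k) < 1 -> forall j, (j < 2)%N -> W (Conf qn (hd c) (setreg (rg c) k (payload j))))
  end.

(** In the game where the prover picks the messages, [n] bounds the number of steps to [fin] along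
    all branches of positive probability. *)
Fixpoint reach n c : Prop :=
  fin c \/ (if n is n'.+1 then ~~ (acc (st c) || rej (st c)) /\ exists g, safe_step (reach n') c g
            else False).

Definition safe c := exists n, reach n c.

Lemma safe_step_mono (W W' : conf -> Prop) c g :
  (forall c', W c' -> W' c') -> safe_step W c g -> safe_step W' c g.
Proof.
move=> WW'; rewrite /safe_step; case: prog => [f q' m|k qy qn]; first exact: WW'.
by case=> /WW' ? H; split=> // /H H' j /H' /WW'.
Qed.

Lemma reach_mono n n' c : (n <= n')%N -> reach n c -> reach n' c.
Proof.
elim: n n' c => [|n IH] [|n'] c //= le_n; first by case=> // ?; left.
case=> [?|[H [g Hg]]]; [by left|right; split=> //; exists g].
by apply: safe_step_mono Hg => c'; apply: IH.
Qed.

Lemma safe_fin c : fin c -> safe c.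
Proof. by move=> ?; exists 0%N; left. Qed.

Lemma safe_cons c g : ~~ (acc (st c) || rej (st c)) -> safe_step safe c g -> safe c.
Proof.
move=> H Hg; suff [n Hn] : exists n, safe_step (reach n) c g by exists n.+1; right; split=> //; exists g.
move: Hg; rewrite /safe_step; case: prog => [f q' m|k qy qn]; first by [].
case=> -[n0 H0]; case: (boolP (pyes (rg c k) < 1)) => [_ H1|_ _]; last by exists n0.
have [n1 A1] := H1 isT 0%N isT; have [n2 A2] := H1 isT 1%N isT.
exists (maxn n0 (maxn n1 n2)); split; first by apply: reach_mono H0; rewrite leq_maxl.
move=> _ [|[|//]] _; first by apply: reach_mono A1; rewrite !leq_max leqnn orbT.
by apply: reach_mono A2; rewrite !leq_max leqnn !orbT.
Qed.

Variables (c0 : conf) (alpha : rat).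
Hypothesis fin_weigh : forall c, fin c -> ~~ (acc (st c) || rej (st c)) /\
  exists k qy qn, [/\ forall g, prog (st c) (tape_at w (hd c)) g = Weigh k qy qn, acc qy,
    pyes (rg c k) = alpha &
    forall j, (j < 2)%N -> safe (Conf qn (hd c) (setreg (rg c) k (payload j)))].

Definition level c n := reach n c /\ forall m, reach m c -> (n <= m)%N.

Lemma level_exists n c : reach n c -> exists2 m, (m <= n)%N & level c m.
Proof.
elim/ltn_ind: n => n IH Hn.
case: (classic (exists2 m, (m < n)%N & reach m c)) => [[m lt_mn Hm]|H].
  by have [m' le_m' ?] := IH m lt_mn Hm; exists m' => //; apply: leq_trans le_m' (ltnW lt_mn).
exists n => //; split=> // m Hm; rewrite leqNgt; apply/negP=> lt_mn; apply: H; by exists m.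
Qed.

(* Descending along a minimal level makes a positional strategy terminate. *)
Definition strategy (g0 : G) c : G :=
  epsilon (inhabits g0) (fun g => forall n, level c n.+1 -> safe_step (reach n) c g).

(** The level is unique, so the property that [epsilon] asks for all [n] is satisfiable. A level
    [n.+1] excludes [fin c], which would give level 0. *)
Lemma strategyP g0 c n : level c n.+1 -> safe_step (reach n) c (strategy g0 c).
Proof.
move=> L; apply: (epsilon_spec (inhabits g0)
  (fun g => forall n, level c n.+1 -> safe_step (reach n) c g)) (L).
case: (L) => [[fc|[_ [g Hg]]] mL]; first by have := mL 0%N (or_introl fc).
exists g => m [Rm mL']; suff -> : m = n by [].
by apply/eqP; rewrite eqn_leq -ltnS (mL' _ L.1) -ltnS (mL _ Rm).
Qed.

(** The history lists all messages and outcomes; replaying it from [c0] recovers the configuration,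
    so a positional strategy is a prover. *)
Definition honest (g0 : G) : prover V :=
  fun hist => strategy g0 (foldl (fun c go => next c go.1 go.2) c0 hist).

Definition tracks c hist := foldl (fun c go => next c go.1 go.2) c0 hist = c.

Lemma tracks_rcons c hist g o : tracks c hist -> tracks (next c g o) (rcons hist (g, o)).
Proof. by rewrite /tracks -cats1 foldl_cat => ->. Qed.

Definition secured g0 (b : rat) :=
  forall c hist, tracks c hist -> safe c -> exists t, b <= hp (honest g0) acc t c hist.

Lemma secured_weigh g0 c hist k qy qn b0 b1 (P := honest g0) :
  ~~ (acc (st c) || rej (st c)) ->
  prog (st c) (tape_at w (hd c)) (P hist) = Weigh k qy qn ->
  (exists t, b0 <= hp P acc t (next c (P hist) (weighed k 2)) (rcons hist (P hist, weighed k 2))) ->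
  (pyes (rg c k) < 1 -> forall j, (j < 2)%N ->
    exists t, b1 <= hp P acc t (next c (P hist) (weighed k j)) (rcons hist (P hist, weighed k j))) ->
  exists t, pyes (rg c k) * b0 + (1 - pyes (rg c k)) * b1 <= hp P acc t c hist.
Proof.
move=> H E [t0 H0] H1.
have [p1|] := boolP (pyes (rg c k) < 1); last first.
  rewrite -leNgt => p1; have Ep : pyes (rg c k) = 1 by apply/eqP; rewrite eq_le pyes_le1.
  exists t0.+1; rewrite (hp_weigh _ _ H E) !big_cons big_nil addr0 wprob_yes Ep subrr mul0r mul1r addr0.
  rewrite mul1r addrA; apply: le_trans H0 _; rewrite lerDr.
  by apply: addr_ge0; apply: mulr_ge0; rewrite ?wprob_ge0 ?hp_ge0.
have [t1 A1] := H1 p1 0%N isT; have [t2 A2] := H1 p1 1%N isT.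
set T := maxn t0 (maxn t1 t2); exists T.+1.
have l0 : (t0 <= T)%N by rewrite leq_maxl.
have l1 : (t1 <= T)%N by rewrite !leq_max leqnn orbT.
have l2 : (t2 <= T)%N by rewrite !leq_max leqnn !orbT.
rewrite (hp_weigh _ _ H E) !big_cons big_nil addr0 wprob_yes -wprob_sum mulrDl [leLHS]addrC [leRHS]addrA.
by apply: lerD; [apply: lerD|]; apply: ler_wpM2l; rewrite ?wprob_ge0 ?pyes_ge0 //;
  [apply: le_trans A1 _|apply: le_trans A2 _|apply: le_trans H0 _]; apply: hp_mono.
Qed.

(** Strong induction on the bound of [reach] leads to the weighing in [fin], which accepts with
    probability [alpha] and otherwise stays safe, hence secured with [b]. *)
Lemma secured_round g0 b : b <= 1 -> secured g0 b -> secured g0 (alpha + (1 - alpha) * b).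
Proof.
move=> b1 sb c hist tr [n]; elim/ltn_ind: n c hist tr => n IH c hist tr Hn.
have [m le_m L] := level_exists Hn.
case: m le_m L => [_ [[fc|[]] _]|m lt_m L].
  have [H [k [qy [qn [E ay <- sn]]]]] := fin_weigh fc.
  rewrite -[X in X + _]mulr1.
  apply: secured_weigh (E _) _ _ => //.
    by exists 0%N; rewrite (next_weigh _ (E _)) hp_halted /= ay.
  move=> _ j lt_j; apply: sb; first exact: tracks_rcons.
  by rewrite (next_weigh _ (E _)); case: j lt_j => [|[|]] // ?; apply: sn.
have := strategyP g0 L; have Pg : honest g0 hist = strategy g0 c by rewrite /honest tr.
have H : ~~ (acc (st c) || rej (st c)).
  by case: (L) => -[fc|[]//] /(_ 0%N (or_introl fc)).
rewrite -Pg /safe_step; case E: prog => [f q' mv|k qy qn].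
  rewrite -(next_op (fun=> None) E) => R.
  by have [t Ht] := IH m lt_m _ _ (tracks_rcons _ _ tr) R; exists t.+1; rewrite (hp_op _ _ H E).
have e0 : payload 2 = (0, 0) by [].
(* Before [fin] all branches carry the same bound, written here as a convex combination of itself to
   fit [secured_weigh]. *)
case=> R0 R1; rewrite (_ : _ + _ = pyes (rg c k) * (alpha + (1 - alpha) * b) +
  (1 - pyes (rg c k)) * (alpha + (1 - alpha) * b)); last by ring.
apply: secured_weigh (E) _ _ => //.
  by apply: (IH m) => //; [exact: tracks_rcons|rewrite (next_weigh _ E) e0].
move=> p1 j lt_j; apply: (IH m) => //; first exact: tracks_rcons.
by rewrite (next_weigh _ E); case: j lt_j => [|[|]] // ?; apply: R1.
Qed.

(** A round raises a bound [v] to [v + alpha * (1 - v)], a gain of at least [alpha * d] while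
    [v < 1 - d]. *)
Lemma honest_accepts (g0 : G) : 0 < alpha -> alpha <= 1 -> safe c0 ->
  forall d, 0 < d -> exists t, 1 - d <= hp (honest g0) acc t c0 [::].
Proof.
move=> a0 a1 sc0 d d0.
have [v le_v [_ sv]] : exists2 v, 1 - d <= v & v <= 1 /\ secured g0 v; last first.
  by have [t Ht] := sv c0 [::] erefl sc0; exists t; apply: le_trans le_v Ht.
apply: (@climb (fun v => v <= 1 /\ secured g0 v) (alpha * d)).
- exact: mulr_gt0.
- by split=> // c hist _ _; exists 0%N; exact: hp_ge0.
move=> v [v1 sv] v0 lt_v; have le_ad : alpha * d <= alpha * (1 - v) by rewrite ler_wpM2l ?(ltW a0) // lerBrDr addrC -lerBrDr ltW.
have le_a1 : alpha * (1 - v) <= 1 * (1 - v) by rewrite ler_wpM2r // subr_ge0.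
split; first by lra.
move=> c hist tr sc; have [t Ht] := secured_round v1 sv tr sc.
by exists t; apply: le_trans Ht; lra.
Qed.

End Honest.

End Word.
End Program.

(** * The knapsack game as a run of a nondeterministic parser *)

(* [PNum ex snd ne ch]: reading the first or second ([snd]) number of a
   universal or existential ([ex]) pair; [ne] records that a digit was read and
   [ch] which number of the pair was chosen. *)
Inductive pstate :=
  PS0 | PS1 | PLp of bool | PNum of bool & bool & bool & bool | PEx | PAll | PErr.

Definition pstate_code (p : pstate) : 'I_7 * (bool * bool * bool * bool) :=
  match p with
  | PS0 => (inord 0, (false, false, false, false))
  | PS1 => (inord 1, (false, false, false, false))
  | PLp q => (inord 2, (q, false, false, false))
  | PNum q s n c => (inord 3, (q, s, n, c))
  | PEx => (inord 4, (false, false, false, false))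
  | PAll => (inord 5, (false, false, false, false))
  | PErr => (inord 6, (false, false, false, false))
  end.

Definition pstate_decode (x : 'I_7 * (bool * bool * bool * bool)) : pstate :=
  let: (i, (q, s, n, c)) := x in
  nth PErr [:: PS0; PS1; PLp q; PNum q s n c; PEx; PAll; PErr] i.

Lemma pstate_codeK : cancel pstate_code pstate_decode.
Proof. by case=> *; rewrite /= inordK. Qed.

HB.instance Definition _ := Finite.copy pstate (can_type pstate_codeK).

(** The bit [c] is consulted only at an opening parenthesis, so a run makes one choice per pair
    although every letter comes with a bit. *)
Definition pnext (c : bool) (p : pstate) (d : kgsym) : pstate :=
  match p, d with
  | PS0, K0 | PS0, K1 | PS1, K0 | PS1, K1 => PS1
  | PS1, KAll | PAll, KAll => PLp false
  | PEx, KEx => PLp true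
  | PLp q, KLp => PNum q false false c
  | PNum q s _ ch, K0 | PNum q s _ ch, K1 => PNum q s true ch
  | PNum q false true ch, KComma => PNum q true false ch
  | PNum q true true _, KRp => if q then PAll else PEx
  | _, _ => PErr
  end.

Definition pfinal (p : pstate) := match p with PS1 | PAll => true | _ => false end.

(* The pair (total, current number): the chosen numbers of the pairs quantified
   as in pass [m] are subtracted from the total, which starts as [S]. *)
Definition parith (m : bool) (p : pstate) (d : kgsym) : aff :=
  match p, d with
  | PS0, K0 | PS1, K0 => if m then aff_id else Aff 2 0 0 1 0 0
  | PS0, K1 | PS1, K1 => if m then aff_id else Aff 2 0 0 1 1 0
  | PNum _ _ _ _, K0 => Aff 1 0 0 2 0 0
  | PNum _ _ _ _, K1 => Aff 1 0 0 2 0 1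
  | PNum q s _ ch, KComma | PNum q s _ ch, KRp =>
      if (q == m) && (s == ch) then Aff 1 (-1) 0 0 0 0 else Aff 1 0 0 0 0 0
  | _, _ => aff_id
  end.

Definition kgstate := (pstate * (rat * rat))%type.

Definition kgstep (m c : bool) (d : kgsym) (x : kgstate) : kgstate :=
  (pnext c x.1 d, aff_app (parith m x.1 d) x.2).

Fixpoint kgrun (m : bool) (o : seq kgsym) (x y : kgstate) : Prop :=
  if o is d :: o' then exists c, kgrun m o' (kgstep m c d x) y else x = y.

Definition bitfold := foldl (fun a (b : bool) => (a.*2 + b)%N).

Lemma kgstep_bit m c q s ne ch x n (b : bool) :
  kgstep m c (if b then K1 else K0) (PNum q s ne ch, (x, n%:R)) =
  (PNum q s true ch, (x, (n.*2 + b)%N%:R)).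
Proof.
by case: b; case: s; case: ne; rewrite /kgstep /aff_app /= -muln2 natrD natrM; congr (_, (_, _)) => //; ring.
Qed.

Lemma kgrun_bits m a o q s ne ch x n y :
  kgrun m (bits a ++ o) (PNum q s ne ch, (x, n%:R)) y <->
  kgrun m o (PNum q s (ne || (a != [::])) ch, (x, (bitfold n a)%:R)) y.
Proof.
elim: a n ne => [|b a IH] n ne /=; first by rewrite orbF.
rewrite orbT -[true]/(true || (a != [::])); split=> [[c]|H].
  by rewrite kgstep_bit => /IH.
by exists true; rewrite kgstep_bit; apply/IH.
Qed.

Lemma kgstep_bitS m c p x (b : bool) : p = PS0 \/ p = PS1 ->
  kgstep m c (if b then K1 else K0) (p, (x, 0)) = (PS1, (if m then x else 2 * x + b%:R, 0)).
Proof.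
by move=> [] ->; case: b; case: m; rewrite /kgstep /aff_app /=; congr (_, (_, _)) => //; ring.
Qed.

(** The first pass builds the total from the digits of [S]; the second one keeps the total [x]
    inherited from the first. *)
Lemma kgrun_bitsS m a o x n y :
  (kgrun m (bits a ++ o) (PS1, (if m then x else n%:R, 0)) y <->
  kgrun m o (PS1, (if m then x else (bitfold n a)%:R, 0)) y).
Proof.
elim: a n => [|b a IH] n //=.
have E c : kgstep m c (if b then K1 else K0) (PS1, (if m then x else n%:R, 0)) =
   (PS1, (if m then x else (n.*2 + b)%N%:R, 0)).
  rewrite kgstep_bitS; last by right.
  by case: m {IH} => //; rewrite -muln2 natrD natrM mulrC.
split=> [[c]|H]; first by rewrite E => /IH.
by exists true; rewrite E; apply/IH.
Qed.

Lemma kgrun_bitsS0 m a o x y : a != [::] ->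
  kgrun m (bits a ++ o) (PS0, (if m then x else 0, 0)) y <->
  kgrun m o (PS1, (if m then x else (bitval a)%:R, 0)) y.
Proof.
case: a => [//|b a] _ /=.
have E c : kgstep m c (if b then K1 else K0) (PS0, (if m then x else 0, 0)) =
   (PS1, (if m then x else (0.*2 + b)%N%:R, 0)).
  rewrite kgstep_bitS; last by left.
  by case: m => //; rewrite mulr0 add0r.
split=> [[c]|H]; first by rewrite E => /kgrun_bitsS.
by exists true; rewrite E; apply/kgrun_bitsS.
Qed.

Definition block := (seq bool * seq bool * seq bool * seq bool)%type.

Definition wf_block (blk : block) :=
  let: (a, b, e, f) := blk in [&& a != [::], b != [::], e != [::] & f != [::]].

Definition selected (m c : bool) (blk : block) : nat :=
  let: (a, b, e, f) := blk in
  bitval (if m then (if c then f else e) else (if c then b else a)).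

Lemma kgstep_commit m c q s ne ch x y d : d = KComma \/ d = KRp ->
  (kgstep m c d (PNum q s ne ch, (x, y))).2 = (if (q == m) && (s == ch) then x - y else x, 0).
Proof.
by case=> ->; rewrite /kgstep /aff_app /=; case: ifP => _ /=; congr pair; ring.
Qed.

(** The comma and the closing parenthesis commit the number just read if it is the chosen one.
    Exactly one number is subtracted when the quantifier is that of the pass, and none otherwise. *)
Lemma kgrun_pair m q a b o x ch y : a != [::] -> b != [::] ->
  kgrun m (bits a ++ KComma :: bits b ++ KRp :: o) (PNum q false false ch, (x, 0)) y <->
  kgrun m o (if q then PAll else PEx,
    (if q == m then x - (bitval (if ch then b else a))%:R else x, 0)) y.
Proof.
move=> a0 b0.
have E1 c : kgstep m c KComma (PNum q false true ch, (x, (bitval a)%:R)) =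
   (PNum q true false ch, (if (q == m) && ~~ ch then x - (bitval a)%:R else x, 0%:R)).
  by rewrite [LHS]surjective_pairing kgstep_commit; [case: ch|left].
have E2 c x' : kgstep m c KRp (PNum q true true ch, (x', (bitval b)%:R)) =
   (if q then PAll else PEx, (if (q == m) && ch then x' - (bitval b)%:R else x', 0)).
  by rewrite [LHS]surjective_pairing kgstep_commit; [case: (ch)|right].
have E3 : (if (q == m) && ch then
      (if (q == m) && ~~ ch then x - (bitval a)%:R else x) - (bitval b)%:R
      else if (q == m) && ~~ ch then x - (bitval a)%:R else x) =
   (if q == m then x - (bitval (if ch then b else a))%:R else x).
  by case: (q == m) => //; case: ch {E1 E2}.
split=> [/(kgrun_bits _ _ _ _ _ _ _ _ 0) /=|H].
  rewrite a0 -[bitfold _ _]/(bitval a) => -[c1]; rewrite E1 => /kgrun_bits /=.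
  by rewrite b0 -[bitfold _ _]/(bitval b) => -[c2]; rewrite E2 E3.
apply/(kgrun_bits _ _ _ _ _ _ _ _ 0); rewrite a0 -[bitfold _ _]/(bitval a) /=; exists true.
rewrite E1; apply/kgrun_bits; rewrite b0 -[bitfold _ _]/(bitval b) /=; exists true.
by rewrite E2 E3.
Qed.

Lemma kgstep_id m c d p x : parith m p d = aff_id -> kgstep m c d (p, x) = (pnext c p d, x).
Proof. by rewrite /kgstep /= => ->; rewrite aff_app_id. Qed.

Lemma kgrun_block m blk o p x y : pfinal p -> wf_block blk ->
  kgrun m (enc_block blk ++ o) (p, (x, 0)) y <->
  exists c, kgrun m o (PAll, (x - (selected m c blk)%:R, 0)) y.
Proof.
case: blk => [[[a b] e] f] fp /and4P[a0 b0 e0 f0].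
rewrite /enc_block /= -!(catA, cat_cons) /=.
have E0 c : kgstep m c KAll (p, (x, 0)) = (PLp false, (x, 0)).
  by rewrite kgstep_id; case: p fp.
have E1 c q x' : kgstep m c KLp (PLp q, x') = (PNum q false false c, x') by rewrite kgstep_id.
have E2 c x' : kgstep m c KEx (PEx, x') = (PLp true, x') by rewrite kgstep_id.
split.
  case=> c0 [c]; rewrite E0 E1 => /(kgrun_pair _ _ _ _ _ _ a0 b0) [c1 [c']]; rewrite E2 E1.
  rewrite -(cat1s KRp) -/(cat _ _) => /(kgrun_pair _ _ _ _ _ _ e0 f0) H.
  (* Each of the two pairs has its own choice; the one that counts belongs to the quantifier treated
     in pass [m]. *)
  by exists (if m then c' else c); case: m H {E0 E1 E2}.
case=> c H; exists true; exists c; rewrite E0 E1; apply/kgrun_pair => //.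
exists true; exists c; rewrite E2 E1; apply/kgrun_pair => //.
by case: m H {E0 E1 E2}.
Qed.

Fixpoint selsum (m : bool) (cs : seq bool) (blks : seq block) : nat :=
  match cs, blks with
  | c :: cs', blk :: blks' => (selected m c blk + selsum m cs' blks')%N
  | _, _ => 0%N
  end.

Lemma kgrun_blocks m blks p x y : pfinal p -> all wf_block blks ->
  kgrun m (flatten (map enc_block blks)) (p, (x, 0)) y <->
  exists cs, size cs = size blks /\
    y = (if blks is [::] then p else PAll, (x - (selsum m cs blks)%:R, 0)).
Proof.
elim: blks p x => [|blk blks IH] p x fp /=.
  move=> _; split; first by move=> <-; exists [::]; rewrite subr0.
  by move=> [cs [/size0nil -> ->]]; rewrite subr0.
move=> /andP[wb wbs]; split.
  move=> /(kgrun_block _ _ _ _ fp wb)[c] /(IH PAll _ isT wbs)[cs [sz ->]].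
  exists (c :: cs); split; first by rewrite /= sz.
  by rewrite /= natrD opprD addrA; case: (blks).
case=> -[[]//|c cs [[sz] Ey]]; apply/kgrun_block => //; exists c; apply/(IH PAll _ isT wbs).
by exists cs; split=> //; rewrite Ey /= natrD opprD addrA; case: (blks).
Qed.

Lemma kgrun_enc m S blks x y : S != [::] -> all wf_block blks ->
  kgrun m (enc_KG S blks) (PS0, (if m then x else 0, 0)) y <->
  exists cs, size cs = size blks /\
    y = (if blks is [::] then PS1 else PAll,
         ((if m then x else (bitval S)%:R) - (selsum m cs blks)%:R, 0)).
Proof.
move=> S0 wb; split; first by move=> /(kgrun_bitsS0 _ _ _ _ S0) /kgrun_blocks; apply.
by move=> H; apply/(kgrun_bitsS0 _ _ _ _ S0)/kgrun_blocks.
Qed.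

(* The words leading from a parser state to acceptance. *)
Definition suffix_of (p : pstate) (o : seq kgsym) : Prop :=
  exists blks : seq block, all wf_block blks /\
  let tl := flatten (map enc_block blks) in
  match p with
  | PS0 => exists2 S, S != [::] & o = bits S ++ tl
  | PS1 => exists S, o = bits S ++ tl
  | PLp false => exists a b e f, wf_block (a, b, e, f) /\
      o = KLp :: bits a ++ KComma :: bits b ++ KRp :: KEx :: KLp :: bits e ++ KComma :: bits f ++ KRp :: tl
  | PNum false false ne _ => exists a b e f, [&& ne || (a != [::]), b != [::], e != [::] & f != [::]] /\
      o = bits a ++ KComma :: bits b ++ KRp :: KEx :: KLp :: bits e ++ KComma :: bits f ++ KRp :: tl
  | PNum false true ne _ => exists b e f, [&& ne || (b != [::]), e != [::] & f != [::]] /\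
      o = bits b ++ KRp :: KEx :: KLp :: bits e ++ KComma :: bits f ++ KRp :: tl
  | PEx => exists e f, [&& e != [::] & f != [::]] /\
      o = KEx :: KLp :: bits e ++ KComma :: bits f ++ KRp :: tl
  | PLp true => exists e f, [&& e != [::] & f != [::]] /\
      o = KLp :: bits e ++ KComma :: bits f ++ KRp :: tl
  | PNum true false ne _ => exists e f, [&& ne || (e != [::]) & f != [::]] /\
      o = bits e ++ KComma :: bits f ++ KRp :: tl
  | PNum true true ne _ => exists f, (ne || (f != [::])) /\ o = bits f ++ KRp :: tl
  | PAll => o = tl
  | PErr => False
  end.

(** Every word has runs, so well-formedness has to come from the final state. By induction, each
    letter is put in front of a suffix accepted from the next state. *)
Lemma kgrun_suffix m o x y : kgrun m o x y -> pfinal y.1 -> suffix_of x.1 o.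
Proof.
elim: o x => [|d o IH] [p z] /=.
  by move=> <- /=; case: p => // _; exists [::]; split=> //; exists [::].
case=> c /IH{}IH /IH{IH}; rewrite /kgstep /=.
case: p => [||[]|[] [] [] ch||| ]; case: d => //=;
  case=> blks [wb] //=; try by case.
(* A digit extends the first numeral; a comma or closing parenthesis stands after a numeral with no
   digits left; an opening parenthesis or [KEx] changes no numeral. *)
all: first
  [ by case=> a ->; exists blks; split=> //; exists (false :: a)
  | by case=> a ->; exists blks; split=> //; exists (true :: a)
  | by case=> a [_ ->]; exists blks; split=> //; exists (false :: a)
  | by case=> a [_ ->]; exists blks; split=> //; exists (true :: a)
  | by case=> a [b [H ->]]; exists blks; split=> //; exists (false :: a), b
  | by case=> a [b [H ->]]; exists blks; split=> //; exists (true :: a), b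
  | by case=> a [b [e [H ->]]]; exists blks; split=> //; exists (false :: a), b, e
  | by case=> a [b [e [H ->]]]; exists blks; split=> //; exists (true :: a), b, e
  | by case=> a [b [e [f [H ->]]]]; exists blks; split=> //; exists (false :: a), b, e, f
  | by case=> a [b [e [f [H ->]]]]; exists blks; split=> //; exists (true :: a), b, e, f
  | by move=> ->; exists blks; split=> //; exists [::]
  | by case=> a [H ->]; exists blks; split=> //; exists [::], a
  | by case=> a [b [H ->]]; exists blks; split=> //; exists [::], a, b
  | by case=> a [b [e [H ->]]]; exists blks; split=> //; exists [::], a, b, e
  | by case=> a [b [H ->]]; exists blks; split=> //; exists a, b
  | by case=> a [b [e [f [H ->]]]]; exists blks; split=> //; exists a, b, e, f
  | idtac ].
  (* A [KAll] turns the four numerals of the suffix into a new first block, here after the digits of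
     [S], below after a complete block. *)
  case=> a [b [e [f [H ->]]]]; exists ((a, b, e, f) :: blks); split; first by rewrite /= H.
  by exists [::]; rewrite /= -!(catA, cat_cons).
case=> a [b [e [f [H ->]]]]; exists ((a, b, e, f) :: blks); split; first by rewrite /= H.
by rewrite /= -!(catA, cat_cons).
Qed.

Lemma selsum_big S cs ds (blks : seq block) : size cs = size blks -> size ds = size blks ->
  (S == \sum_(i < size (map (fun blk : block =>
              let: (a, b, e, f) := blk in (bitval a, bitval b, bitval e, bitval f)) blks))
           let: (a, b, e, f) := nth (0, 0, 0, 0)%N (map (fun blk : block =>
              let: (a, b, e, f) := blk in (bitval a, bitval b, bitval e, bitval f)) blks) i in
           ((if nth false cs i then b else a) + (if nth false ds i then f else e)))%N =
  (S%:R - (selsum false cs blks)%:R - (selsum true ds blks)%:R == 0 :> rat).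
Proof.
move=> szc szd; set s := (\sum_(i < _) _)%N.
have -> : s = (selsum false cs blks + selsum true ds blks)%N; last first.
  by rewrite -[RHS]subr_eq0 subr0 -addrA -opprD -natrD subr_eq0 eqr_nat.
rewrite {}/s {S}; elim: blks cs ds szc szd => [|[[[a b] e] f] blks IH] [|c cs] [|d ds] //=.
  by rewrite big_ord0.
case=> szc [szd]; rewrite big_ord_recl /= IH //.
by case: c; case: d; rewrite /=; lia.
Qed.

Definition kgmid (x : kgstate) : kgstate := (PS0, (x.2.1, 0)).

Definition kgwin (x : kgstate) : bool := pfinal x.1 && (x.2.1 == 0).

(** Choice vectors and runs correspond by [kgrun_enc]. From right to left, a single winning second
    run shows that the word is well formed; then each vector [cs] gives a first run, whose answer
    yields the vector [ds]. *)
Lemma LKG_run o : LKG o <->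
  forall x, kgrun false o (PS0, (0, 0)) x -> exists2 y, kgrun true o (kgmid x) y & kgwin y.
Proof.
split.
  case=> S [blks [S0 [wb [-> game]]]] x /(@kgrun_enc false _ _ 0 _ S0 wb)[cs [szc ->]].
  have [|ds [szd /eqP E]] := game cs; first by rewrite size_map.
  rewrite size_map in szd.
  have {}E : (bitval S)%:R - (selsum false cs blks)%:R - (selsum true ds blks)%:R == 0 :> rat.
    by rewrite -selsum_big.
  eexists; first by apply/(@kgrun_enc true) => //; exists ds; split; first exact: szd.
  by rewrite /kgwin /= E; case: (blks).
move=> H.
(* The parser never gets stuck, so there is at least one first run to which [H] applies. *)
have total m o' x : exists y, kgrun m o' x y.
  by elim: o' x => [|d o' IH] x; [exists x|have [y Hy] := IH (kgstep m true d x); exists y, true].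
have [x Hx] := total false o (PS0, (0, 0)).
have [y Hy /andP[fy _]] := H x Hx.
have [blks [wb [S S0 Eo]]] := kgrun_suffix Hy fy.
exists S, blks; split=> //; split=> //; split=> // cs.
move=> szc'; have szc : size cs = size blks by rewrite szc' size_map.
have [|z Hz /andP[_ z0]] := H (if blks is [::] then PS1 else PAll,
         ((bitval S)%:R - (selsum false cs blks)%:R, 0)).
  by rewrite Eo; apply/(@kgrun_enc false _ _ 0) => //; exists cs.
move: Hz; rewrite Eo => /(@kgrun_enc true _ _ _ _ S0 wb)[ds [szd Ez]].
exists ds; split; first by rewrite size_map.
by apply/eqP; apply: etrans (selsum_big (bitval S) szc szd) _; move: z0; rewrite Ez.
Qed.

(** * Encoding configurations by numbers *)

Definition is_left (S : Type) (s : tsym S) := if s is LEnd then true else false.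
Definition is_right (S : Type) (s : tsym S) := if s is REnd then true else false.

Lemma is_left_tape (S : Type) (w : seq S) i : is_left (tape_at w i) = (i == 0)%N.
Proof. by case: i => //= i; case: drop. Qed.

Lemma is_right_tape (S : Type) (w : seq S) i : is_right (tape_at w i) = (size w < i)%N.
Proof.
case: i => //= i; rewrite ltnS -subn_eq0 -size_drop; by case: drop.
Qed.

Definition tsym_code (S : Type) (s : tsym S) : option (option S) :=
  match s with LEnd => None | REnd => Some None | Sym a => Some (Some a) end.

Definition tsym_decode (S : Type) (s : option (option S)) : tsym S :=
  match s with None => LEnd | Some None => REnd | Some (Some a) => Sym a end.

Lemma tsym_codeK (S : Type) : cancel (@tsym_code S) (@tsym_decode S).
Proof. by case. Qed.

(** The base-[b] value with the most significant digit first, as a sweep from left to right computes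
    it. The rational version below admits the fractional digits of predictions. *)
Fixpoint hornat (b : nat) (f : nat -> nat) k : nat :=
  if k is k'.+1 then (b * hornat b f k' + f k')%N else 0%N.

Fixpoint horner (b : rat) (f : nat -> rat) k : rat :=
  if k is k'.+1 then b * horner b f k' + f k' else 0.

Lemma horner_nat b f k : horner b%:R (fun i => (f i)%:R) k = (hornat b f k)%:R.
Proof. by elim: k => //= k ->; rewrite natrD natrM. Qed.

Lemma digit_inj b x d x' d' : (d < b)%N -> (d' < b)%N ->
  (b * x + d = b * x' + d')%N -> x = x' /\ d = d'.
Proof.
move=> lt_d lt_d' E; have b0 : (0 < b)%N by case: b lt_d {E lt_d'}.
move: E; rewrite !(mulnC b) => E; split.
  by move: (congr1 (divn^~ b) E); rewrite !divnMDl // !divn_small // !addn0.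
by move: (congr1 (modn^~ b) E); rewrite !modnMDl !modn_small.
Qed.

Section Horner.
Variable b : rat.
Hypothesis b0 : b != 0.

Lemma eq_horner f g k : (forall i, (i < k)%N -> f i = g i) -> horner b f k = horner b g k.
Proof.
elim: k => //= k IH E; rewrite IH ?E // => i lt_i; exact: E (ltnW _).
Qed.

Lemma hornerD f g k : horner b (fun i => f i + g i) k = horner b f k + horner b g k.
Proof. by elim: k => [|k IH] /=; rewrite ?addr0 // IH; ring. Qed.

Lemma hornerZ c f k : horner b (fun i => c * f i) k = c * horner b f k.
Proof. by elim: k => [|k IH] /=; rewrite ?mulr0 // IH; ring. Qed.

(** A head marks one position, that is, a number with a single nonzero digit. Moving it to a
    neighbouring position changes the value by a factor [b]. *)
Definition spike (p : nat) (c : rat) (i : nat) : rat := if i == p then c else 0.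

Lemma horner_spike p c k : horner b (spike p c) k = if (p < k)%N then c * b ^+ (k.-1 - p) else 0.
Proof.
elim: k => //= k ->; rewrite /spike ltnS; case: (ltngtP p k) => [lt_pk|lt_kp|->].
- rewrite addr0 mulrCA -exprS; congr (_ * _ ^+ _); lia.
- by rewrite mulr0 addr0.
- by rewrite mulr0 add0r subnn mulr1.
Qed.

Lemma horner_spike_left p c k : (p.+1 < k)%N ->
  horner b (spike p.+1 (b * c)) k = horner b (spike p c) k.
Proof.
move=> lt_p; rewrite !horner_spike lt_p (ltnW lt_p) (mulrC b) -mulrA -exprS.
congr (_ * _ ^+ _); lia.
Qed.

Lemma horner_spike_right p c k : (p.+1 < k)%N ->
  horner b (spike p (b^-1 * c)) k = horner b (spike p.+1 c) k.
Proof. by move=> lt_p; rewrite -(horner_spike_left _ lt_p) mulVKf. Qed.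

End Horner.

Arguments horner : simpl never.
Arguments hornat : simpl never.

(** * Letters of a configuration and the linear prediction of the next configuration *)

Section Letters.
Variables (S : finType) (D : Type) (M : lstm S D).
Local Notation n := (mc M).
Local Notation blk := {ffun 'I_n -> mG M}.
Local Notation nb := #|{: {ffun 'I_n -> mG M}}|.

(* What the configuration shows at a position of the input tape: the [n] work
   cells stored there, the work head if it is on one of them, and whether the
   input head is there. *)
Definition letter := (blk * option 'I_n * bool)%type.

Definition wcode (o : option 'I_n) : nat := if o is Some j then j.+1 else 0%N.

Definition code (l : letter) : nat := (enum_rank l.1.1 + nb * (wcode l.1.2 + n.+1 * l.2))%N.

Definition base : nat := (nb * (n.+1).*2)%N.

Lemma wcode_lt o : (wcode o < n.+1)%N.
Proof. by case: o => [j|] //=; rewrite ltnS ltn_ord. Qed.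

Lemma nb_gt0 : (0 < nb)%N.
Proof. by rewrite -(card_ord nb) (cardD1 (enum_rank [ffun=> mblank M])). Qed.

Lemma code_lt l : (code l < base)%N.
Proof.
rewrite /code /base; case: l => [[bl o] h] /=.
have := ltn_ord (enum_rank bl); have := wcode_lt o.
have : (wcode o + n.+1 * h < (n.+1).*2)%N -> (enum_rank bl < nb)%N ->
  (enum_rank bl + nb * (wcode o + n.+1 * h) < nb * (n.+1).*2)%N.
  move=> lt1 lt2; apply: (@leq_trans (nb * (wcode o + n.+1 * h).+1)).
    by rewrite mulnS ltn_add2r.
  by rewrite leq_mul2l lt1 orbT.
move=> H lt_o lt_b; apply: H lt_b; case: h => /=; lia.
Qed.

Lemma code_inj : injective code.
Proof.
move=> [[bl o] h] [[bl' o'] h']; rewrite /code /= => E.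
have [E2 E1] : (wcode o + n.+1 * h = wcode o' + n.+1 * h')%N /\
    (enum_rank bl : nat) = enum_rank bl'.
  by apply: (@digit_inj nb) => //; rewrite addnC E addnC.
have [E4 E3] : (h : nat) = h' /\ wcode o = wcode o'.
  by apply: (@digit_inj n.+1); rewrite ?wcode_lt // addnC E2 addnC.
congr (_, _, _); last by case: h h' E4 {E2 E} => -[].
- exact/enum_rank_inj/val_inj.
- by case: o o' E3 {E2 E} => [j|] [j'|] //= [/val_inj ->].
Qed.

Definition work_head (p i : nat) : option 'I_n :=
  if (p %/ n == i)%N then insub (p %% n)%N else None.

Definition letter_of (C : tmconf S D M) (i : nat) : letter :=
  ([ffun j : 'I_n => ctape C (n * i + j)], work_head (cwp C) i, cip C == i).

Definition init_letter (s : tsym S) : letter :=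
  ([ffun=> mblank M], if is_left s then insub 0%N else None, is_left s).

Lemma letter_of_init w i : letter_of (tm_init S D M) i = init_letter (tape_at w i).
Proof.
rewrite /letter_of /init_letter /work_head /= is_left_tape div0n mod0n ![0%N == i]eq_sym.
by congr (_, _, _).
Qed.

Definition ishift (mi : move) (s : tsym S) : rat :=
  match mi with
  | MLeft => if is_left s then 1 else base%:R
  | MStay => 1
  | MRight => if is_right s then 1 else base%:R^-1
  end.

(** Cell [j] is coded [j.+1]. Leaving to the left reaches the last cell of the previous block, coded
    [n]; leaving to the right reaches cell 0 of the next one, coded 1. At the left end the head
    stays, as in [move_work]. *)
Definition wshift (mw : move) (s : tsym S) (j : nat) : rat :=
  match mw with
  | MLeft => if (0 < j)%N then j%:R else if is_left s then 1 else base%:R * n%:R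
  | MStay => j.+1%:R
  | MRight => if (j.+1 < n)%N then j.+2%:R else base%:R^-1
  end.

Definition new_blk (bl : blk) (o : option 'I_n) (a : mG M) : blk :=
  if o is Some j then [ffun j' => if j' == j then a else bl j'] else bl.

(* The contribution of the letter [l] to the encoding of the next
   configuration; a head leaving for a neighbouring position is accounted for
   by a factor [base] or [1 / base]. *)
Definition coef (s : tsym S) (a : mG M) (mi mw : move) (l : letter) : rat :=
  (enum_rank (new_blk l.1.1 l.1.2 a))%:R +
  nb%:R * ((if l.1.2 is Some j then wshift mw s j else 0) +
           n.+1%:R * (if l.2 then ishift mi s else 0)).

Definition enc (C : tmconf S D M) k : nat := hornat base (fun i => code (letter_of C i)) k.

Lemma base_neq0 : base%:R != 0 :> rat.
Proof. by rewrite pnatr_eq0 /base muln_eq0 double_eq0 negb_or -lt0n nb_gt0. Qed.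

Hypothesis n_gt0 : (0 < n)%N.

Lemma work_headE p i : work_head p i = if (p %/ n)%N == i then Some (Ordinal (ltn_pmod p n_gt0)) else None.
Proof.
rewrite /work_head; case: eqP => // _; rewrite (insubT (fun x => x < n)%N (ltn_pmod p n_gt0)) /=.
by congr Some; apply: val_inj.
Qed.

Lemma new_blkE (C : tmconf S D M) a i :
  new_blk [ffun j : 'I_n => ctape C (n * i + j)] (work_head (cwp C) i) a =
  [ffun j : 'I_n => if (n * i + j == cwp C)%N then a else ctape C (n * i + j)].
Proof.
rewrite work_headE; apply/ffunP=> j; have E := divn_eq (cwp C) n.
case: eqP => [Ei|ne] /=; rewrite !ffunE.
  congr (if _ then _ else _); apply/eqP/eqP => [->|Ej]; first by rewrite /= -Ei mulnC -E.
  by apply: val_inj => /=; rewrite -Ej mulnC modnMDl modn_small.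
by case: eqP => // Ej; case: ne; rewrite -Ej mulnC divnMDl // divn_small // addn0.
Qed.

Section Step.
Variables (w : seq S) (C : tmconf S D M) (a : mG M) (mi mw : move).
Hypothesis ip_le : (cip C <= (size w).+1)%N.
Hypothesis wp_lt : (cwp C < n * (size w).+1)%N.
Local Notation N := (size w).+2.
Local Notation b := (base%:R : rat).

(** Both sides are spikes, at the old and at the new position of the head; [ishift] supplies the
    power of the base by which they differ. *)
Lemma horner_input :
  horner b (fun i => if cip C == i then ishift mi (tape_at w i) else 0) N =
  horner b (fun i => (move_in (size w).+1 mi (cip C) == i)%:R) N.
Proof.
rewrite (_ : horner b (fun i => (_ == i)%:R) N =
  horner b (spike (move_in (size w).+1 mi (cip C)) 1) N); last first.
  by apply: eq_horner => i _; rewrite /spike eq_sym; case: eqP.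
rewrite (_ : horner b _ N = horner b (spike (cip C) (ishift mi (tape_at w (cip C)))) N); last first.
  by apply: eq_horner => i _; rewrite /spike eq_sym; case: eqP => [->|].
case: mi => /=; rewrite ?is_left_tape ?is_right_tape //.
  case E: (cip C) ip_le => [|p] //= lt_p; rewrite -{2}[b]mulr1 horner_spike_left ?base_neq0 //.
case: ltnP => lt_p; first by congr (horner _ (spike _ _)); lia.
by rewrite -{1}[b^-1]mulr1 horner_spike_right ?base_neq0 //; congr (horner _ (spike _ _)); lia.
Qed.

Lemma horner_work :
  horner b (fun i => if work_head (cwp C) i is Some j then wshift mw (tape_at w i) j else 0) N =
  horner b (fun i => (wcode (work_head (move_work mw (cwp C)) i))%:R) N.
Proof.
rewrite (_ : horner b (fun i => (wcode _)%:R) N =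
  horner b (spike (move_work mw (cwp C) %/ n)%N (move_work mw (cwp C) %% n).+1%:R) N); last first.
  by apply: eq_horner => i _; rewrite /spike work_headE eq_sym; case: eqP.
rewrite (_ : horner b _ N = horner b (spike (cwp C %/ n)%N (wshift mw (tape_at w (cwp C %/ n)) (cwp C %% n))) N); last first.
  by apply: eq_horner => i _; rewrite /spike work_headE eq_sym; case: eqP => [->|].
(* The space bound keeps the block of the work head strictly before the last position, so a move to
   the right stays among the [N] encoded blocks. *)
have lt_p : (cwp C %/ n < (size w).+1)%N by rewrite ltn_divLR // mulnC.
have := divn_eq (cwp C) n; have := ltn_pmod (cwp C) n_gt0.
move: (cwp C %/ n)%N (cwp C %% n)%N lt_p => i j lt_i lt_j E.
have dm p r : (r < n)%N -> ((p * n + r) %/ n = p)%N /\ ((p * n + r) %% n = r)%N.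
  by move=> lt_r; rewrite divnMDl // divn_small // addn0 modnMDl modn_small.
case: mw => /=; rewrite ?is_left_tape E; last first.
- case: ltnP => H.
    by rewrite -addnS; have [-> ->] := dm i j.+1 H.
  have -> : ((i * n + j).+1 = i.+1 * n + 0)%N by lia.
  have [-> ->] := dm i.+1 0%N n_gt0.
  by rewrite -{1}[b^-1]mulr1 horner_spike_right ?base_neq0 //; lia.
- by have [-> ->] := dm i j lt_j.
case: j lt_j {E} => [|j] lt_j /=.
  case: i lt_i => [|i] lt_i /=; first by rewrite mul0n div0n mod0n.
  have -> : ((i.+1 * n + 0).-1 = i * n + n.-1)%N by lia.
  have [|-> ->] := dm i n.-1; first by rewrite prednK.
  by rewrite horner_spike_left ?base_neq0 ?prednK //; lia.
have -> : ((i * n + j.+1).-1 = i * n + j)%N by lia.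
by have [|-> ->] := dm i j; first by lia.
Qed.

(** Split [coef] into its block, work-head and input-head parts. The blocks agree digit by digit
    with those of [C']; the heads do so only after summation, by the two lemmas on spikes. *)
Lemma horner_coef C' : cip C' = move_in (size w).+1 mi (cip C) ->
  cwp C' = move_work mw (cwp C) ->
  (forall i, ctape C' i = if i == cwp C then a else ctape C i) ->
  horner b (fun i => coef (tape_at w i) a mi mw (letter_of C i)) N = (enc C' N)%:R.
Proof.
move=> Ei Ew Et; rewrite -horner_nat.
rewrite /coef /letter_of /code /= !hornerD hornerZ !hornerD hornerZ horner_input horner_work.
rewrite -!hornerZ -!hornerD -!hornerZ -!hornerD; apply: eq_horner => i _.
rewrite Ei Ew new_blkE !natrD !natrM natrD natrM; congr (_%:R + _).
by congr (nat_of_ord (enum_rank _)); apply/ffunP=> j; rewrite !ffunE Et.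
Qed.

End Step.

Lemma tm_step_delta (w : seq S) (C : tmconf S D M) q' a mi mw od : ~~ mhalt M (cq C) ->
  mdelta M (cq C) (tape_at w (cip C)) (ctape C (cwp C)) = (q', a, mi, mw, od) ->
  let C' := tm_step S D M w C in
  [/\ cq C' = q', cip C' = move_in (size w).+1 mi (cip C), cwp C' = move_work mw (cwp C),
      cout C' = cout C ++ (if od is Some d then [:: d] else [::])
    & forall i, ctape C' i = if i == cwp C then a else ctape C i].
Proof. by move=> /negPf H E; rewrite /tm_step H E. Qed.

End Letters.

(** * The verifier *)

Inductive phase := Start | Init | Rewind | Step | Coin | Sweep | Scale | Check | Arith
  | Mid | FinalScale | FinalCheck | Lottery | Acc | Rej.

Definition phases :=
  [:: Start; Init; Rewind; Step; Coin; Sweep; Scale; Check; Arith;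
      Mid; FinalScale; FinalCheck; Lottery; Acc; Rej].

Definition phase_code (p : phase) : 'I_15 :=
  inord match p with
  | Start => 0 | Init => 1 | Rewind => 2 | Step => 3 | Coin => 4 | Sweep => 5 | Scale => 6
  | Check => 7 | Arith => 8 | Mid => 9 | FinalScale => 10 | FinalCheck => 11 | Lottery => 12
  | Acc => 13 | Rej => 14 end%N.

Lemma phase_codeK : cancel phase_code (fun i => nth Rej phases i).
Proof. by case; rewrite /= inordK. Qed.

HB.instance Definition _ := Finite.copy phase (can_type phase_codeK).

(* [regC p] holds the value predicted for the current configuration and that of
   the letters received, [regC (~~ p)] the prediction under construction; they
   exchange their roles after each step.  [regK] serves the arithmetic of the
   game, [regA] the lottery that decides on acceptance, and [regT] the coins. *)
Definition regK : 'I_5 := @Ordinal 5 2 isT.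
Definition regA : 'I_5 := @Ordinal 5 3 isT.
Definition regT : 'I_5 := @Ordinal 5 4 isT.
Definition regC (b : bool) : 'I_5 := if b then @Ordinal 5 1 isT else @Ordinal 5 0 isT.

Definition ops (b : bool) (f1 f2 fK fA fT : aff) : 'I_5 -> aff := fun k =>
  if k == regC b then f1 else if k == regC (~~ b) then f2 else
  if k == regK then fK else if k == regA then fA else fT.

(** [regT] is left out: it is reloaded before each toss. *)
Definition view (z : 'I_5 -> rat * rat) b p1 p2 pK pA :=
  [/\ z (regC b) = p1, z (regC (~~ b)) = p2, z regK = pK & z regA = pA].

Lemma view_ops z b p1 p2 pK pA f1 f2 fK fA fT : view z b p1 p2 pK pA ->
  view (fun k => aff_app (ops b f1 f2 fK fA fT k) (z k)) b
    (aff_app f1 p1) (aff_app f2 p2) (aff_app fK pK) (aff_app fA pA).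
Proof. by case: b => -[<- <- <- <-]. Qed.

Lemma view_swap z b p1 p2 pK pA : view z b p1 p2 pK pA -> view z (~~ b) p2 p1 pK pA.
Proof. by case: b => -[<- <- <- <-]. Qed.

Lemma view_setC z b p1 p2 pK pA p : view z b p1 p2 pK pA ->
  view (setreg z (regC b) p) b p p2 pK pA.
Proof. by case: b => -[*]; split. Qed.

Lemma view_setK z b p1 p2 pK pA p : view z b p1 p2 pK pA ->
  view (setreg z regK p) b p1 p2 p pA.
Proof. by case: b => -[*]; split. Qed.

Lemma view_setT z b p1 p2 pK pA p : view z b p1 p2 pK pA ->
  view (setreg z regT p) b p1 p2 pK pA.
Proof. by case: b => -[<- <- <- <-]. Qed.

Lemma app_ids b z : (fun k => aff_app (ops b aff_id aff_id aff_id aff_id aff_id k) (z k)) = z.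
Proof.
apply: functional_extensionality => k; rewrite /ops.
by do ?case: ifP => _; rewrite aff_app_id.
Qed.

Lemma aff_appX r d x y : aff_app (Aff r 0 0 1 d 0) (x, y) = (r * x + d, y).
Proof. by rewrite /aff_app /=; congr pair; ring. Qed.

Lemma aff_appY r d x y : aff_app (Aff 1 0 0 r 0 d) (x, y) = (x, r * y + d).
Proof. by rewrite /aff_app /=; congr pair; ring. Qed.

(** * The control of the verifier and its deterministic phases *)

Section Protocol.
Variables (S : finType) (M : lstm S kgsym) (eps : rat).
Hypothesis n_gt0 : (0 < mc M)%N.
Hypothesis eps_gt0 : 0 < eps.

Local Notation b := ((base M)%:R : rat).

(* Phase, pass, index of the check register, machine state, parser state,
   announced input and work symbols, choice for the next pair. *)
Definition ctl : finType :=
  (phase * bool * bool * mQ M * pstate * option (option S) * mG M * bool)%type.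

(* A message announces the symbols under the two heads, a choice, and a letter
   of the current configuration. *)
Definition msg : finType := (option (option S) * mG M * bool * letter M)%type.

Definition delta q (u : option (option S)) a := mdelta M q (tsym_decode u) a.

Definition agrees (s : tsym S) (u : option (option S)) (a : mG M) (l : letter M) :=
  (l.2 ==> (tsym_code s == u)) && (if l.1.2 is Some j then l.1.1 j == a else true).

(** Only [Step] and [Sweep] read the message. In [Coin] the next choice is the toss in the first
    pass and the one announced in [Step] in the second. [regA] starts at [(2 / eps, - (2 / eps))]
    and doubles at each simulated step, so that acceptance becomes as rare as the number of tosses
    requires. *)
Definition prog (x : ctl) (s : tsym S) (g : msg) : instr ctl 5 :=
  let: (ph, m, p, q, y, u, a, c) := x in
  let i := aff_id in
  let stay ph f := Op f (ph, m, p, q, y, u, a, c) MStay in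
  match ph with
  | Start => Op (ops false (aff_const 0 0) (aff_const 0 0) (aff_const 0 0)
                   (aff_const (2 / eps) (- (2 / eps))) i)
               (Init, false, false, mq0 M, PS0, u, a, c) MStay
  | Init => Op (ops p (Aff b 0 0 1 (code (init_letter M s))%:R 0) i i i i)
              (if is_right s then Rewind else Init, m, p, q, y, u, a, c)
              (if is_right s then MStay else MRight)
  | Rewind => Op (ops p i i i i i)
              (if is_left s then Step else Rewind, m, p, q, y, u, a, c)
              (if is_left s then MStay else MLeft)
  | Step => if mhalt M q then stay (if m then FinalScale else Mid) (ops p i i i i i)
            else Op (ops p i i i (Aff 2 0 0 2 0 0) (aff_const (1 / 2) 0))
                   (Coin, m, p, q, y, g.1.1.1, g.1.1.2, g.1.2) MStay
  | Coin => Weigh regT (Sweep, m, p, q, y, u, a, if m then c else true)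
                       (Sweep, m, p, q, y, u, a, if m then c else false)
  | Sweep =>
      if agrees s u a g.2 then
        let: (_, a', mi, mw, _) := delta q u a in
        Op (ops p (Aff 1 0 0 b 0 (code g.2)%:R) (Aff b 0 0 1 (coef s a' mi mw g.2) 0) i i i)
           (if is_right s then Scale else Sweep, m, p, q, y, u, a, c)
           (if is_right s then MStay else MRight)
      else stay Rej (ops p i i i i i)
  | Scale => stay Check (ops p (Aff (1 / eps) (- (1 / eps)) (- (1 / eps)) (1 / eps) 0 0) i i i i)
  | Check => Weigh (regC p) (Arith, m, p, q, y, u, a, c) (Rej, m, p, q, y, u, a, c)
  | Arith =>
      let: (q', _, _, _, od) := delta q u a in
      Op (ops p (aff_const 0 0) i (if od is Some d then parith m y d else i) i i)
         (Rewind, m, ~~ p, q', if od is Some d then pnext c y d else y, u, a, c) MStay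
  | Mid => Op (ops false (aff_const 0 0) (aff_const 0 0) (Aff 1 0 0 0 0 0) i i)
              (Init, true, false, mq0 M, PS0, u, a, c) MStay
  | FinalScale => if pfinal y then stay FinalCheck (ops p i i (Aff (1 / eps) 0 (- (1 / eps)) 0 0 0) i i)
                  else stay Rej (ops p i i i i i)
  | FinalCheck => Weigh regK (Lottery, m, p, q, y, u, a, c) (Rej, m, p, q, y, u, a, c)
  | Lottery => Weigh regA (Acc, m, p, q, y, u, a, c) (Start, m, p, q, y, u, a, c)
  | Acc | Rej => stay ph (ops p i i i i i)
  end.

Definition phase_of (x : ctl) : phase := let: (ph, _, _, _, _, _, _, _) := x in ph.
Definition accepting (x : ctl) := if phase_of x is Acc then true else false.
Definition rejecting (x : ctl) := if phase_of x is Rej then true else false.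

Variable w : seq S.
Local Notation N := (size w).+2.
Local Notation conf := (@conf ctl 5).
Local Notation guar := (@guar S ctl msg 5 (Start, false, false, mq0 M, PS0, None, mblank M, false) accepting rejecting prog w).
Local Notation running c := (~~ (accepting (st c) || rejecting (st c))).

(** Backward closure along steps that depend neither on the message nor on chance. Guaranteed
    rejection and safety both have it, so these phases are treated once for soundness and
    completeness. *)
Record closed (W : conf -> Prop) : Prop := Closed {
  closed_op : forall c f q' mv, running c ->
    (forall g, prog (st c) (tape_at w (hd c)) g = Op f q' mv) ->
    W (Conf q' (move_in (size w).+1 mv (hd c)) (fun k => aff_app (f k) (rg c k))) -> W c;
  closed_sure : forall c k qy qn, running c ->
    (forall g, prog (st c) (tape_at w (hd c)) g = Weigh k qy qn) ->
    pyes (rg c k) = 1 -> W (Conf qy (hd c) (setreg (rg c) k (0, 0))) -> W c }.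

Lemma closed_guar v : closed (fun c => guar c v).
Proof.
split=> [c f q' mv H E G|c k qy qn H E p1 G]; apply: guar_step => // g; rewrite E //.
exists v, 0; split=> //; first by move=> *; apply: guar0.
by rewrite p1 subrr mul0r mul1r addr0.
Qed.

(** The value predicted for [C] is present, no letter has been received and no new prediction begun;
    [u], [a], [c] are arbitrary leftovers of earlier steps. *)
Definition at_step (W : conf -> Prop) m p (C : tmconf S kgsym M) (x : kgstate) (A : rat) :=
  forall u a c z, view z p ((enc C N)%:R, 0) (0, 0) x.2 (A, - A) ->
  W (Conf (Step, m, p, cq C, x.1, u, a, c) 0 z).

Section Closed.
Variable W : conf -> Prop.
Hypothesis cW : closed W.

Lemma rewind m p q y u a c i z :
  W (Conf (Step, m, p, q, y, u, a, c) 0 z) -> W (Conf (Rewind, m, p, q, y, u, a, c) i z).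
Proof.
move=> H; elim: i => [|i IH].
  by apply: (closed_op cW) => //=; rewrite app_ids.
apply: (closed_op cW) => //; rewrite is_left_tape app_ids; exact: IH.
Qed.

Lemma init m p y u a c i z p2 pK pA : (i < N)%N ->
  view z p ((enc (tm_init S kgsym M) i)%:R, 0) p2 pK pA ->
  (forall z, view z p ((enc (tm_init S kgsym M) N)%:R, 0) p2 pK pA ->
    W (Conf (Step, m, p, mq0 M, y, u, a, c) 0 z)) ->
  W (Conf (Init, m, p, mq0 M, y, u, a, c) i z).
Proof.
move=> lt_i V H; have [d Ed] : exists d, (size w).+1 = (i + d)%N by exists ((size w).+1 - i)%N; lia.
elim: d i z Ed V {lt_i} => [|d IH] i z Ed V.
all: apply: (closed_op cW) => //=; rewrite is_right_tape.
all: have := view_ops (Aff b 0 0 1 (code (init_letter M (tape_at w i)))%:R 0) aff_id aff_id aff_id aff_id V.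
all: rewrite !aff_app_id aff_appX -(letter_of_init M w i) -natrM -natrD.
all: rewrite -[(_ * _ + _)%N]/(enc (tm_init S kgsym M) i.+1) => V'.
  rewrite ifT; last lia.
  apply: rewind; apply: H; move: V'; suff -> : i.+1 = N by []; lia.
rewrite ifF; last lia.
rewrite ifF; last lia.
rewrite (_ : move_in _ _ _ = i.+1); last by rewrite /=; lia.
by apply: IH => //; lia.
Qed.

Lemma view_triv z p : view z p (z (regC p)) (z (regC (~~ p))) (z regK) (z regA).
Proof. by []. Qed.

Lemma start m p q y u a c z : at_step W false false (tm_init S kgsym M) (PS0, (0, 0)) (2 / eps) ->
  W (Conf (Start, m, p, q, y, u, a, c) 0 z).
Proof.
move=> H; apply: (closed_op cW) => //=.
apply: (init (p2 := (0, 0)) (pK := (0, 0)) (pA := (2 / eps, - (2 / eps)))) => //; last exact: H.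
have := view_ops (aff_const 0 0) (aff_const 0 0) (aff_const 0 0)
   (aff_const (2 / eps) (- (2 / eps))) aff_id (view_triv z false).
by rewrite !aff_app_const.
Qed.

Lemma mid p C x A : mhalt M (cq C) -> at_step W true false (tm_init S kgsym M) (kgmid x) A ->
  at_step W false p C x A.
Proof.
move=> hC H u a c z V; apply: (closed_op cW) => //=; first by move=> g; rewrite hC.
rewrite app_ids; apply: (closed_op cW) => //=.
apply: (init (p2 := (0, 0)) (pK := (x.2.1, 0)) (pA := (A, - A))) => //; last exact: H.
have V' : view z false (z (regC false)) (z (regC true)) x.2 (A, - A) by case: V.
have := view_ops (aff_const 0 0) (aff_const 0 0) (Aff 1 0 0 0 0 0) aff_id aff_id V'.
rewrite !aff_app_const aff_app_id; suff -> : aff_app (Aff 1 0 0 0 0 0) x.2 = (x.2.1, 0) by [].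
by rewrite /aff_app /=; congr pair; ring.
Qed.

Lemma pyes_scaled x y : pyes (aff_app (Aff (1 / eps) (- (1 / eps)) (- (1 / eps)) (1 / eps) 0 0) (x, y))
  = (1 + 2 * (`|x - y| / eps))^-1.
Proof.
rewrite /aff_app /= (_ : 1 / eps * x + _ + 0 = (x - y) / eps); last by ring.
rewrite (_ : - (1 / eps) * x + _ + 0 = - ((x - y) / eps)); last by ring.
by rewrite pyes_opp normrM normfV (gtr0_norm eps_gt0).
Qed.

Definition kgopt (m c : bool) (od : option kgsym) (x : kgstate) : kgstate :=
  if od is Some d then kgstep m c d x else x.

Definition tm_out (C : tmconf S kgsym M) : option kgsym :=
  (mdelta M (cq C) (tape_at w (cip C)) (ctape C (cwp C))).2.

(** Equal coordinates pass the check with certainty; then the parser advances and the two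
    configuration registers exchange roles. *)
Lemma after_sweep m p (C : tmconf S kgsym M) x A c z i v (C' := tm_step S kgsym M w C) :
  ~~ mhalt M (cq C) ->
  view z p (v, v) ((enc C' N)%:R, 0) x.2 (A, - A) ->
  at_step W m (~~ p) C' (kgopt m c (tm_out C) x) A ->
  W (Conf (Scale, m, p, cq C, x.1, tsym_code (tape_at w (cip C)), ctape C (cwp C), c) i z).
Proof.
move=> hC V H; apply: (closed_op cW) => //=.
have := view_ops (Aff (1 / eps) (- (1 / eps)) (- (1 / eps)) (1 / eps) 0 0)
  aff_id aff_id aff_id aff_id V.
rewrite !aff_app_id; move: (fun k => _) => z1 V1.
apply: (closed_sure cW) => //=.
  by case: V1 => -> _ _ _; rewrite pyes_scaled subrr normr0 mul0r mulr0 addr0 invr1.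
have := view_setC (0, 0) V1; move: (setreg _ _ _) => z2 V2 {z1 V1}.
case E: (mdelta M (cq C) (tape_at w (cip C)) (ctape C (cwp C))) => [[[[q' a'] mi] mw] od].
have [Eq _ _ _ _] := tm_step_delta hC E.
apply: (closed_op cW) => //=; first by move=> g; rewrite /delta tsym_codeK E.
apply: rewind; move: H; rewrite /tm_out E /= -Eq => H.
pose x' := kgopt m c od x; have -> : (if od is Some d then pnext c x.1 d else x.1) = x'.1.
  by rewrite /x'; case: (od).
apply: H; apply: view_swap.
have := view_ops (aff_const 0 0) aff_id (if od is Some d then parith m x.1 d else aff_id) aff_id aff_id V2.
rewrite !aff_app_id aff_app_const.
by have -> : aff_app (if od is Some d then parith m x.1 d else aff_id) x.2 = x'.2
  by rewrite /x'; case: (od) => //=; rewrite aff_app_id.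
Qed.

End Closed.

(** * Soundness of one simulated step *)

Lemma natr_dist (h k : nat) : h != k -> 1 <= `|h%:R - k%:R : rat|.
Proof.
rewrite ler_normr neq_ltn => /orP[lt_hk|lt_kh]; apply/orP; [right|left].
  by move: lt_hk; rewrite -(ler_nat rat) -natr1; lra.
by move: lt_kh; rewrite -(ler_nat rat) -natr1; lra.
Qed.

(** From [d >= 1] follows [1 + 2 * (d / eps) >= 2 / eps]; distinct naturals are at such a
    distance. *)
Lemma small_pass d : 1 <= d -> (1 + 2 * (d / eps))^-1 <= eps / 2.
Proof.
move=> d1; rewrite -[eps / 2]invrK lef_pV2 ?posrE ?invf_div.
- have : 1 / eps <= d / eps by rewrite ler_pM2r ?invr_gt0.
  by lra.
- have : 0 < d / eps by rewrite divr_gt0 //; lra.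
  by lra.
- by rewrite divr_gt0.
Qed.

Lemma dev_le1 : 1 - eps / 2 <= 1.
Proof. by move: eps_gt0 => e0; lra. Qed.

Lemma scale_dev m p q y u a c i z (h k : nat) : h != k -> z (regC p) = (h%:R, k%:R) ->
  guar (Conf (Scale, m, p, q, y, u, a, c) i z) (1 - eps / 2).
Proof.
move=> ne E; apply: (closed_op (closed_guar _)) => //=.
move Ez1 : (fun k => _) => z1.
have {}E : z1 (regC p) = aff_app (Aff (1 / eps) (- (1 / eps)) (- (1 / eps)) (1 / eps) 0 0) (h%:R, k%:R).
  by rewrite -E -Ez1 /ops eqxx.
apply: guar_step => //= _; exists 0, 1; split=> [|j _|].
- exact: guar0.
- exact: guar_rej.
by rewrite E pyes_scaled; have := small_pass (natr_dist ne); lra.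
Qed.

(** A wrong prefix cannot be repaired: each letter appends a digit below the base, so by [digit_inj]
    the two values stay different until the check, whatever the prover sends. *)
Lemma sweep_dev (C : tmconf S kgsym M) m p q y u a c i z (k : nat) : (i < N)%N -> k != enc C i ->
  z (regC p) = ((enc C N)%:R, k%:R) ->
  guar (Conf (Sweep, m, p, q, y, u, a, c) i z) (1 - eps / 2).
Proof.
move=> lt_i; have [d Ed] : exists d, (size w).+1 = (i + d)%N by exists ((size w).+1 - i)%N; lia.
elim: d i z k Ed {lt_i} => [|d IH] i z k Ed ne E.
all: apply: guar_step => // g; rewrite /=; case: agrees; last (apply: guar_rej => //; exact: dev_le1).
all: case: delta => [[[[_ a'] mi] mw] _]; rewrite is_right_tape.
all: have ne' : (base M * k + code g.2 != enc C i.+1)%N by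
  apply: contraNneq ne => /(digit_inj (code_lt _) (code_lt _))[-> _].
all: move Ez1 : (fun k => _) => z1.
all: have {}E : z1 (regC p) = ((enc C N)%:R, (base M * k + code g.2)%N%:R) by
  rewrite -Ez1 /ops eqxx E aff_appY natrD natrM.
  rewrite ifT; last lia.
  by apply: scale_dev E; rewrite eq_sym; move: ne'; suff -> : i.+1 = N by []; lia.
rewrite ifF; last lia.
rewrite ifF; last lia.
rewrite (_ : move_in _ _ _ = i.+1); last by rewrite /=; lia.
by apply: IH E; first lia.
Qed.

Definition in_bounds (C : tmconf S kgsym M) :=
  (cip C <= (size w).+1)%N && (cwp C < mc M * (size w).+1)%N.

(* The part of the next configuration encoded after [i] positions of a sweep
   in which [u] and [a] were announced as the scanned symbols. *)
Definition next_enc (C : tmconf S kgsym M) u a i : rat :=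
  let: (_, a', mi, mw, _) := delta (cq C) u a in
  horner b (fun j => coef (tape_at w j) a' mi mw (letter_of C j)) i.

Definition vouched (C : tmconf S kgsym M) u (a : mG M) i :=
  ((cip C < i)%N ==> (u == tsym_code (tape_at w (cip C)))) &&
  ((cwp C %/ mc M < i)%N ==> (a == ctape C (cwp C))).

(** When a true letter carries a head, [agrees] forces the announced symbol to be the one scanned
    there. *)
Lemma vouchedS C u a i : vouched C u a i -> agrees (tape_at w i) u a (letter_of C i) ->
  vouched C u a i.+1.
Proof.
move=> /andP[v1 v2] /andP[/= a1 a2]; apply/andP; split; apply/implyP; rewrite ltnS leq_eqVlt.
  by case/orP=> [/eqP E|/(implyP v1)//]; move: a1; rewrite E eqxx -E /= eq_sym.
case/orP=> [/eqP E|/(implyP v2)//]; move: a2; rewrite work_headE // E eqxx ffunE /=.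
by rewrite -E mulnC -divn_eq eq_sym.
Qed.

Lemma vouched_all C u a : in_bounds C -> vouched C u a N ->
  u = tsym_code (tape_at w (cip C)) /\ a = ctape C (cwp C).
Proof.
move=> /andP[le_i lt_w] /andP[/implyP v1 /implyP v2]; split; first by apply/eqP/v1.
apply/eqP/v2; rewrite ltn_divLR // (leq_trans lt_w) // mulnC leq_mul2r; lia.
Qed.

Lemma next_enc_all C : in_bounds C -> ~~ mhalt M (cq C) ->
  next_enc C (tsym_code (tape_at w (cip C))) (ctape C (cwp C)) N =
  (enc (tm_step S kgsym M w C) N)%:R.
Proof.
move=> /andP[le_i lt_w] hC; rewrite /next_enc /delta tsym_codeK.
case E: mdelta => [[[[q' a'] mi] mw] od]; have [_ Ei Ew _ Et] := tm_step_delta hC E.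
exact: horner_coef.
Qed.

Lemma next_encS C u a i : let: (_, a', mi, mw, _) := delta (cq C) u a in
  next_enc C u a i.+1 = b * next_enc C u a i + coef (tape_at w i) a' mi mw (letter_of C i).
Proof. by rewrite /next_enc; case: delta => [[[[q' a'] mi] mw] od]. Qed.

(** At each position the true letter preserves the invariant, a letter contradicting the
    announcement is rejected at once, and any other letter is a deviation caught at the check. After
    a sweep of true letters the announcements are vouched for, so the prediction is the true next
    value. *)
Lemma sweep_guar m p C x u a c A i z v : (i < N)%N -> in_bounds C -> ~~ mhalt M (cq C) ->
  v <= 1 - eps / 2 -> vouched C u a i ->
  view z p ((enc C N)%:R, (enc C i)%:R) (next_enc C u a i, 0) x.2 (A, - A) ->
  at_step (fun c => guar c v) m (~~ p) (tm_step S kgsym M w C) (kgopt m c (tm_out C) x) A ->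
  guar (Conf (Sweep, m, p, cq C, x.1, u, a, c) i z) v.
Proof.
move=> lt_i bC hC le_v + + H.
have [d Ed] : exists d, (size w).+1 = (i + d)%N by exists ((size w).+1 - i)%N; lia.
elim: d i z Ed {lt_i} => [|d IH] i z Ed vC V.
all: apply: guar_step => // -[g l]; rewrite /=; case ag: agrees; last (apply: guar_rej => //; exact: le_trans le_v dev_le1).
all: have := next_encS C u a i; case Edl : delta => [[[[q' a'] mi] mw] od] Ene; rewrite is_right_tape.
all: have := view_ops (Aff 1 0 0 b 0 (code l)%:R) (Aff b 0 0 1 (coef (tape_at w i) a' mi mw l) 0)
  aff_id aff_id aff_id V.
all: rewrite !aff_app_id aff_appX aff_appY -natrM -natrD; move: (fun k => _) => z1 V1.
all: have [El|ne] := eqVneq l (letter_of C i).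
- rewrite ifT; last lia.
  rewrite El -Ene -[(_ * _ + _)%N]/(enc C i.+1) (_ : i.+1 = N) in V1; last lia.
  rewrite El in ag; have := vouchedS vC ag; rewrite (_ : i.+1 = N); last lia.
  move=> /(vouched_all bC)[Eu Ea]; rewrite {}Eu {}Ea in V1 *.
  rewrite next_enc_all // in V1.
  exact: (after_sweep (closed_guar v) _ hC V1 H).
- rewrite ifT; last lia.
  apply: guar_le le_v _; case: V1 => V1 _ _ _; apply: scale_dev V1.
  rewrite (_ : N = i.+1); last lia.
  by apply: contra_neq ne => /(digit_inj (code_lt _) (code_lt _))[_ /code_inj].
- rewrite ifF; last lia.
  rewrite ifF; last lia.
  rewrite (_ : move_in _ _ _ = i.+1); last by rewrite /=; lia.
  rewrite El -Ene -[(_ * _ + _)%N]/(enc C i.+1) in V1.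
  by apply: IH => //; [lia|apply: vouchedS => //; rewrite -El].
rewrite ifF; last lia.
rewrite ifF; last lia.
rewrite (_ : move_in _ _ _ = i.+1); last by rewrite /=; lia.
apply: guar_le le_v _; case: V1 => V1 _ _ _; apply: sweep_dev V1; first lia.
by apply: contra_neq ne => /(digit_inj (code_lt _) (code_lt _))[_ /code_inj].
Qed.

Lemma vouched0 C u a : vouched C u a 0.
Proof. by []. Qed.

Lemma next_enc0 C u a : next_enc C u a 0 = 0.
Proof. by rewrite /next_enc; case: delta => [[[[q' a'] mi] mw] od]. Qed.

Lemma pyes_coin : pyes (1 / 2, 0) = 1 / 2.
Proof. by []. Qed.

(** The bound is the average over a fair coin. The hypothesis ranges over all [y] because the prover
    is free to announce any choice. *)
Lemma step_guar m p C x A (v : bool -> rat) : in_bounds C -> ~~ mhalt M (cq C) ->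
  (forall c, v c <= 1 - eps / 2) ->
  (forall y c, at_step (fun d => guar d (v c)) m (~~ p) (tm_step S kgsym M w C)
      (kgopt m (if m then y else c) (tm_out C) x) (2 * A)) ->
  at_step (fun d => guar d ((v true + v false) / 2)) m p C x A.
Proof.
move=> bC hC le_v H u a c z V.
apply: guar_step => // g; rewrite /= (negPf hC).
have := view_ops aff_id aff_id aff_id (Aff 2 0 0 2 0 0) (aff_const (1 / 2) 0) V.
move Ez1 : (fun k => _) => z1; rewrite !aff_app_id.
rewrite (_ : aff_app (Aff 2 0 0 2 0 0) (A, - A) = (2 * A, - (2 * A))); last first.
  by rewrite /aff_app /=; congr pair; ring.
move=> V1; have zT : z1 regT = (1 / 2, 0) by rewrite -Ez1 -[RHS](aff_app_const _ _ (z regT)); case: (p).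
have sw d p' : guar (Conf (Sweep, m, p, cq C, x.1, g.1.1.1, g.1.1.2, if m then g.1.2 else d) 0
   (setreg z1 regT p')) (v d).
  by apply: sweep_guar (le_v d) (vouched0 _ _ _) _ (H g.1.2 d) => //; rewrite next_enc0; apply: view_setT.
apply: guar_step => //= _; exists (v true), (v false); split=> //.
by rewrite zT pyes_coin; lra.
Qed.

(** * Whole passes over the output of the machine *)

Fixpoint outs fuel (C : tmconf S kgsym M) : seq (option kgsym) :=
  if fuel is fuel'.+1 then
    if mhalt M (cq C) then [::] else tm_out C :: outs fuel' (tm_step S kgsym M w C)
  else [::].

Definition halts_in fuel (C : tmconf S kgsym M) := mhalt M (cq (iter fuel (tm_step S kgsym M w) C)).

Lemma tm_step_halted C : mhalt M (cq C) -> tm_step S kgsym M w C = C.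
Proof. by rewrite /tm_step => ->. Qed.

Lemma outs_cout fuel C :
  cout (iter fuel (tm_step S kgsym M w) C) = cout C ++ pmap id (outs fuel C).
Proof.
elim: fuel C => [|fuel IH] C; first by rewrite cats0.
rewrite iterSr /=; have [hC|hC] := boolP (mhalt M (cq C)).
  rewrite cats0 tm_step_halted //; elim: fuel {IH} => //= fuel IH.
  by rewrite -iterS iterSr tm_step_halted.
rewrite IH /tm_out; case E: mdelta => [[[[q' a'] mi] mw] od].
by have [_ _ _ -> _] := tm_step_delta hC E; rewrite -catA; case: (od).
Qed.

Definition bounded C := forall t, in_bounds (iter t (tm_step S kgsym M w) C).

Lemma boundedS C : bounded C -> bounded (tm_step S kgsym M w C).
Proof. by move=> H t; rewrite -iterSr. Qed.

Lemma halts_inS fuel C : halts_in fuel.+1 C -> halts_in fuel (tm_step S kgsym M w C).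
Proof. by rewrite /halts_in iterSr. Qed.

Lemma kgrun_opt m c od os x y : kgrun m (pmap id os) (kgopt m c od x) y ->
  kgrun m (pmap id (od :: os)) x y.
Proof. by case: od => [d|] //= H; exists c. Qed.

Definition step_all (W : conf -> Prop) m := forall p C x A, in_bounds C -> ~~ mhalt M (cq C) ->
  (forall y c, at_step W m (~~ p) (tm_step S kgsym M w C)
      (kgopt m (if m then y else c) (tm_out C) x) (2 * A)) -> at_step W m p C x A.

Lemma guar_step_all v m : v <= 1 - eps / 2 -> step_all (fun d => guar d v) m.
Proof.
move=> le_v p C x A bC hC H.
have -> : v = ((fun=> v) true + (fun=> v) false) / 2 by lra.
by apply: (step_guar (v := fun=> v)) => // y c; have -> : (v + v) / 2 = v by lra.
Qed.

(** [outs] has one entry per machine step, silent steps included, so its size counts the doublings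
    of [regA]. *)
Lemma pass_all W m fuel p C x A : step_all W m -> bounded C -> halts_in fuel C ->
  (forall p' C' y, mhalt M (cq C') -> kgrun m (pmap id (outs fuel C)) x y ->
     at_step W m p' C' y (2 ^+ size (outs fuel C) * A)) ->
  at_step W m p C x A.
Proof.
move=> sW; elim: fuel p C x A => [|fuel IH] p C x A bC hC H.
  by rewrite -[A]mul1r; apply: H.
move: H => /=; have [h|h] := boolP (mhalt M (cq C)) => H.
  by rewrite -[A]mul1r; apply: H.
apply: sW => // [|y c]; first exact: (bC 0%N).
apply: IH; [exact: boundedS|exact: halts_inS|move=> p' C' y' hC' r].
by rewrite mulrA -exprSr; apply: H => //; apply: kgrun_opt r.
Qed.

(** One bad run suffices: over [k] steps its choices are tossed with probability at least
    [1 / 2 ^+ k], and then [vb] replaces [vg]. In the induction the toss that follows this run gets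
    [mix] and the other one [vg]. *)
Lemma pass_bad fuel p C x A vg vb :
  vg <= vb -> vb <= 1 - eps / 2 -> bounded C -> halts_in fuel C ->
  (forall p' C' y, mhalt M (cq C') -> kgrun false (pmap id (outs fuel C)) x y ->
     at_step (fun d => guar d vg) false p' C' y (2 ^+ size (outs fuel C) * A)) ->
  (exists2 y, kgrun false (pmap id (outs fuel C)) x y & forall p' C', mhalt M (cq C') ->
     at_step (fun d => guar d vb) false p' C' y (2 ^+ size (outs fuel C) * A)) ->
  at_step (fun d => guar d (vg + (vb - vg) / 2 ^+ size (outs fuel C))) false p C x A.
Proof.
move=> le_g le_b; elim: fuel p C x A => [|fuel IH] p C x A bC hC.
  rewrite /= => _ [y <-]; rewrite mul1r => /(_ p C hC) H.
  by rewrite expr0 divr1 addrC subrK.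
rewrite /=; have [h|h] := boolP (mhalt M (cq C)).
  rewrite /= => _ [y <-]; rewrite mul1r => /(_ p C h) H.
  by rewrite expr0 divr1 addrC subrK.
set C' := tm_step S kgsym M w C; set os := outs fuel C'; set k := size os => Hg [y Hy Hb].
set mix := vg + (vb - vg) / 2 ^+ k.
have k0 : 0 < (2 ^+ k : rat) by rewrite exprn_gt0.
have k1 : 1 <= (2 ^+ k : rat) by rewrite exprn_ege1.
have le_gm : vg <= mix by rewrite lerDl divr_ge0 ?subr_ge0 // ltW.
have le_mb : mix <= vb.
  have : (vb - vg) / 2 ^+ k <= vb - vg by rewrite ler_pdivrMr // ler_peMr // subr_ge0.
  by rewrite /mix; lra.
have -> : vg + (vb - vg) / 2 ^+ k.+1 = (mix + vg) / 2.
  by rewrite /mix exprS; field; rewrite gt_eqF.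
(* At an output letter the bad run dictates [c0]; at a silent step any value will do. *)
have [c0 Hc0] : exists c0, kgrun false (pmap id os) (kgopt false c0 (tm_out C) x) y.
  by move: Hy => /=; case: (tm_out C) => [d|] /=; [|move=> ?; exists true].
have bC' := boundedS bC; have hC' := halts_inS hC.
have Gg c : at_step (fun d => guar d vg) false (~~ p) C' (kgopt false c (tm_out C) x) (2 * A).
  apply: (@pass_all _ _ fuel) => //; first exact: guar_step_all (le_trans le_g le_b).
  by move=> p' C1 y' h1 r; rewrite mulrA -exprSr; apply: Hg => //; apply: kgrun_opt r.
have Gm : at_step (fun d => guar d mix) false (~~ p) C' (kgopt false c0 (tm_out C) x) (2 * A).
  apply: IH => //; last by exists y => // p' C1 h1; rewrite mulrA -exprSr; apply: Hb.
  by move=> p' C1 y' h1 r; rewrite mulrA -exprSr; apply: Hg => //; apply: kgrun_opt r.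
have -> : (mix + vg) / 2 = ((fun c => if c == c0 then mix else vg) true +
    (fun c => if c == c0 then mix else vg) false) / 2.
  by case: (c0) => //=; rewrite addrC.
apply: (step_guar (v := fun c => if c == c0 then mix else vg)) => //; first exact: (bC 0%N).
  by move=> c; case: eqP => _; [exact: le_trans le_mb le_b|exact: le_trans le_g le_b].
by move=> y' c; case: eqP => [->|_].
Qed.

(** * The final test and the lottery against an arbitrary prover *)

Lemma final_scaled x y : aff_app (Aff (1 / eps) 0 (- (1 / eps)) 0 0 0) (x, y) = (x / eps, - (x / eps)).
Proof. by rewrite /aff_app /=; congr pair; ring. Qed.

Definition starts_with (v : rat) := forall m p q y u a c z,
  guar (Conf (Start, m, p, q, y, u, a, c) 0 z) v.

(** Acceptance is possible only through the lottery, and losing it starts a new round worth [v]. A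
    failed test rejects, which is even better. *)
Lemma final_guar v p C x A : mhalt M (cq C) -> starts_with v -> 0 <= v -> v <= 1 ->
  at_step (fun d => guar d ((1 - pyes (A, - A)) * v)) true p C x A.
Proof.
move=> hC sv v0 v1 u a c z V.
have le1 : (1 - pyes (A, - A)) * v <= 1.
  by rewrite mulr_ile1 ?subr_ge0 ?pyes_le1 // gerBl pyes_ge0.
apply: (closed_op (closed_guar _)) => //=; first by move=> g; rewrite hC.
rewrite app_ids; case fx: (pfinal x.1); last first.
  apply: (closed_op (closed_guar _)) => //=; first by move=> g; rewrite fx.
  exact: guar_rej.
apply: (closed_op (closed_guar _)) => //=; first by move=> g; rewrite fx.
have := view_ops aff_id aff_id (Aff (1 / eps) 0 (- (1 / eps)) 0 0 0) aff_id aff_id V.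
move: (fun k => _) => z1; rewrite !aff_app_id => V1.
apply: guar_step => //= _; exists ((1 - pyes (A, - A)) * v), 1; split=> [|j _|].
- have [_ _ _ zA] := view_setK (0, 0) V1; move: (setreg _ _ _) zA => z2 zA.
  apply: guar_step => //= _; exists 0, v; split=> [|j _|]; first exact: guar0.
    exact: sv.
  by rewrite zA mulr0 add0r.
- exact: guar_rej.
(* With [P] the probability of passing the test, [P * Q + (1 - P)] is at least [Q] because
   [Q <= 1]. *)
have := pyes_ge0 (z1 regK); have := pyes_le1 (z1 regK).
by move: (pyes (z1 _)) ((1 - _) * v) le1 => P Q; nra.
Qed.

(** A nonzero integer total has absolute value at least 1, so it passes no more easily than a wrong
    configuration; a bad parse is rejected outright. *)
Lemma final_bad p C x A : mhalt M (cq C) -> x.2.1 \is a Num.int -> ~~ kgwin x ->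
  at_step (fun d => guar d (1 - eps / 2)) true p C x A.
Proof.
move=> hC ix nwin u a c z V.
apply: (closed_op (closed_guar _)) => //=; first by move=> g; rewrite hC.
rewrite app_ids; case fx: (pfinal x.1); last first.
  apply: (closed_op (closed_guar _)) => //=; first by move=> g; rewrite fx.
  by apply: guar_rej => //; exact: dev_le1.
move: nwin; rewrite /kgwin fx /= => x0.
apply: (closed_op (closed_guar _)) => //=; first by move=> g; rewrite fx.
have := view_ops aff_id aff_id (Aff (1 / eps) 0 (- (1 / eps)) 0 0 0) aff_id aff_id V.
move: (fun k => _) => z1; rewrite !aff_app_id (surjective_pairing x.2) final_scaled => -[_ _ zK _].
apply: guar_step => //= _; exists 0, 1; split=> [|j _|]; first exact: guar0.
  exact: guar_rej.
rewrite zK pyes_opp normrM normfV (gtr0_norm eps_gt0).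
by have := small_pass (norm_intr_ge1 ix x0); lra.
Qed.

Lemma kgrun_int m o x y : kgrun m o x y -> x.2.1 \is a Num.int -> x.2.2 \is a Num.int ->
  y.2.1 \is a Num.int.
Proof.
elim: o x => [|d o IH] [s [x1 x2]] /=; first by move=> <-.
case=> c /IH{}IH i1 i2; apply: IH; rewrite /kgstep /aff_app /=.
all: case: s => [||q|q t ne ch|||]; case: d => //=; case: m => //=;
  try (case: ifP => _ /=); by rewrite ?rpredD ?rpredM ?rpredN ?rpred0 ?rpred1 ?rpred_nat.
Qed.

Local Notation C0 := (tm_init S kgsym M).

(** * Soundness through repeated rounds *)

Section Reduction.
Variable T : nat.
Hypothesis bC0 : bounded C0.
Hypothesis hC0 : halts_in T C0.
Local Notation o := (pmap id (outs T C0)).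
Local Notation X := (2 ^+ size (outs T C0) : rat).

Lemma X_ge1 : 1 <= X.
Proof. by rewrite exprn_ege1. Qed.

(** The content of [regA] at the lottery: [2 / eps], doubled at each step of both passes. *)
Definition prize : rat := X * (X * (2 / eps)).

Lemma prize_gt0 : 0 < prize.
Proof.
have X0 := lt_le_trans ltr01 X_ge1.
by rewrite /prize !mulr_gt0 // invr_gt0.
Qed.

Lemma at_step_le m p C x A v v' : v' <= v ->
  at_step (fun d => guar d v) m p C x A -> at_step (fun d => guar d v') m p C x A.
Proof. by move=> le_v H u a c z V; exact: guar_le le_v (H u a c z V). Qed.

Lemma lottery_small : pyes (prize, - prize) <= eps / 4 / X.
Proof.
have X1 := X_ge1; have X0 := lt_le_trans ltr01 X1; have e0 := eps_gt0.
rewrite pyes_opp (gtr0_norm prize_gt0) -[leRHS]invrK lef_pV2 ?posrE ?invr_gt0 ?divr_gt0 //; last first.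
  by have := prize_gt0; lra.
rewrite invf_div.
have -> : X / (eps / 4) = 2 * (X * (2 / eps)) by field; rewrite gt_eqF.
have : X * (2 / eps) <= prize by rewrite /prize ler_peMl // !mulr_ge0 ?invr_ge0 ?ltW.
by lra.
Qed.

Hypothesis bad : exists2 x, kgrun false o (PS0, (0, 0)) x &
  forall y, kgrun true o (kgmid x) y -> ~~ kgwin y.

(** Compared with [v], the lottery costs at most [eps / 4 / X] by [lottery_small]. The bad run
    contributes at least [(1 - eps / 2 - v) / X], which exceeds [eps / 2 / X] as [v < 1 - eps]. The
    net gain is [eps / 4 / X]. *)
Lemma round_guar v : starts_with v -> 0 <= v -> v < 1 - eps -> starts_with (v + eps / 4 / X).
Proof.
move=> sv v0 v1 m p q y u a c z; have e0 := eps_gt0.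
have X1 := X_ge1; have X0 := lt_le_trans ltr01 X1.
pose vg := (1 - pyes (prize, - prize)) * v.
have p0 := pyes_ge0 (prize, - prize); have p1 := pyes_le1 (prize, - prize).
have le_gv : vg <= v by rewrite /vg ler_piMl // gerBl.
have le_gb : vg <= 1 - eps / 2 by lra.
apply: (start (closed_guar _)); apply: (at_step_le (v := vg + (1 - eps / 2 - vg) / X)).
  have := lottery_small; rewrite {}/vg in le_gv le_gb *.
  have : 0 < X^-1 by rewrite invr_gt0.
  have : X^-1 <= 1 by rewrite invf_le1.
  move: (pyes _) X^-1 p0 p1 le_gv le_gb => P r p0 p1 le_gv le_gb r1 r0 le_P.
  have h1 : P * v <= P by rewrite ler_piMr //; lra.
  have h2 : 0 <= r * (P * v) by rewrite !mulr_ge0 // ltW.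
  have h3 : r * (eps / 2) <= r * (1 - eps / 2 - v) by rewrite ler_pM2l //; lra.
  by lra.
apply: pass_bad => //.
  move=> p' C' x hC' _; apply: (mid (closed_guar _)) => //.
  apply: (@pass_all _ _ T) => //; first exact: guar_step_all.
  move=> p2 C2 x2 hC2 _; apply: final_guar => //; lra.
have [x rx nx] := bad; exists x => // p' C' hC'; apply: (mid (closed_guar _)) => //.
apply: (@pass_all _ _ T) => //; first exact: guar_step_all.
move=> p2 C2 x2 hC2 r2; apply: final_bad => //; last exact: nx.
apply: (kgrun_int r2) => //; exact: (kgrun_int rx).
Qed.

Lemma starts_with_bound : exists2 v, 1 - eps <= v & starts_with v.
Proof.
apply: (@climb starts_with (eps / 4 / X)).
- by rewrite !divr_gt0 // (lt_le_trans ltr01 X_ge1).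
- by move=> *; apply: guar0.
- exact: round_guar.
Qed.

End Reduction.

(** * Perfect completeness *)

Section Completeness.
Variable T : nat.
Hypothesis bC0 : bounded C0.
Hypothesis hC0 : halts_in T C0.
Local Notation o := (pmap id (outs T C0)).

(** The goal of the honest prover within a round. The head must be at position 0, where a new round
    begins. *)
Definition at_lottery (d : conf) := [/\ phase_of (st d) = Lottery, hd d = 0%N
  & rg d regA = (prize T, - prize T)].

Local Notation safe := (@safe S ctl msg 5 accepting rejecting prog w at_lottery).

Definition msg0 : msg := (None, mblank M, false, init_letter M REnd).

Lemma closed_safe : closed safe.
Proof.
split=> [c f q' mv H E G|c k qy qn H E p1 G]; apply: (safe_cons (g := msg0)) => //;
  by rewrite /safe_step E // p1 ltxx.
Qed.

Lemma agrees_letter C i : agrees (tape_at w i) (tsym_code (tape_at w (cip C))) (ctape C (cwp C))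
  (letter_of C i).
Proof.
apply/andP; split=> /=; first by apply/implyP=> /eqP ->.
rewrite work_headE //; case: eqP => // <-; rewrite ffunE /=.
by rewrite mulnC -divn_eq.
Qed.

(** True letters agree with true announcements, and the check then compares equal values, so this
    prover is never rejected. *)
Lemma sweep_safe m p C x c A i z (u := tsym_code (tape_at w (cip C))) (a := ctape C (cwp C)) :
  (i < N)%N -> in_bounds C -> ~~ mhalt M (cq C) ->
  view z p ((enc C N)%:R, (enc C i)%:R) (next_enc C u a i, 0) x.2 (A, - A) ->
  at_step safe m (~~ p) (tm_step S kgsym M w C) (kgopt m c (tm_out C) x) A ->
  safe (Conf (Sweep, m, p, cq C, x.1, u, a, c) i z).
Proof.
move=> lt_i bC hC + H.
have [d Ed] : exists d, (size w).+1 = (i + d)%N by exists ((size w).+1 - i)%N; lia.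
elim: d i z Ed {lt_i} => [|d IH] i z Ed V.
all: apply: (safe_cons (g := (None, mblank M, false, letter_of C i))) => //.
all: rewrite /safe_step /= agrees_letter.
all: have := next_encS C u a i; rewrite -/u -/a.
all: case Edl : delta => [[[[q' a'] mi] mw] od] Ene; rewrite is_right_tape.
all: have := view_ops (Aff 1 0 0 b 0 (code (letter_of C i))%:R)
  (Aff b 0 0 1 (coef (tape_at w i) a' mi mw (letter_of C i)) 0) aff_id aff_id aff_id V.
all: rewrite !aff_app_id aff_appX aff_appY -natrM -natrD; move: (fun k => _) => z1.
all: rewrite -Ene -[(_ * _ + _)%N]/(enc C i.+1) => V1.
  rewrite ifT; last lia.
  rewrite (_ : i.+1 = N) in V1; last lia.
  rewrite next_enc_all // in V1.
  exact: (after_sweep closed_safe _ hC V1 H).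
rewrite ifF; last lia.
rewrite ifF; last lia.
rewrite (_ : move_in _ _ _ = i.+1); last by rewrite /=; lia.
by apply: IH => //; lia.
Qed.

(** The choice [y] is announced before the toss, hence the order of the quantifiers. *)
Lemma step_safe m p C x A : in_bounds C -> ~~ mhalt M (cq C) ->
  (exists y, forall c, at_step safe m (~~ p) (tm_step S kgsym M w C)
      (kgopt m (if m then y else c) (tm_out C) x) (2 * A)) ->
  at_step safe m p C x A.
Proof.
move=> bC hC [y H] u a c z V.
apply: (safe_cons (g := (tsym_code (tape_at w (cip C)), ctape C (cwp C), y, init_letter M REnd))) => //.
rewrite /safe_step /= (negPf hC).
have := view_ops aff_id aff_id aff_id (Aff 2 0 0 2 0 0) (aff_const (1 / 2) 0) V.
move: (fun k => _) => z1; rewrite !aff_app_id.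
rewrite (_ : aff_app (Aff 2 0 0 2 0 0) (A, - A) = (2 * A, - (2 * A))); last first.
  by rewrite /aff_app /=; congr pair; ring.
move=> V1.
have sw d p' : safe (Conf (Sweep, m, p, cq C, x.1, tsym_code (tape_at w (cip C)), ctape C (cwp C),
    if m then y else d) 0 (setreg z1 regT p')).
  by apply: sweep_safe (H d) => //; rewrite next_enc0; apply: view_setT.
by apply: (safe_cons (g := msg0)) => //; split.
Qed.

Lemma pass_ex fuel p C x y A : bounded C -> halts_in fuel C ->
  kgrun true (pmap id (outs fuel C)) x y ->
  (forall p' C', mhalt M (cq C') -> at_step safe true p' C' y (2 ^+ size (outs fuel C) * A)) ->
  at_step safe true p C x A.
Proof.
elim: fuel p C x A => [|fuel IH] p C x A bC hC.
  by move=> /= -> H; rewrite -[A]mul1r; apply: H.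
move=> /=; have [h|h] := boolP (mhalt M (cq C)) => r H.
  by rewrite -[A]mul1r r; apply: H.
apply: step_safe => //; first exact: (bC 0%N).
have [c0 Hc0] : exists c0, kgrun true (pmap id (outs fuel (tm_step S kgsym M w C)))
    (kgopt true c0 (tm_out C) x) y.
  by move: r => /=; case: (tm_out C) => [d|] /=; [|move=> ?; exists true].
exists c0 => _; apply: IH Hc0 _; [exact: boundedS|exact: halts_inS|].
by move=> p' C' hC'; rewrite mulrA -exprSr; apply: H.
Qed.

Lemma final_safe p C x : mhalt M (cq C) -> kgwin x -> at_step safe true p C x (prize T).
Proof.
move=> hC /andP[fx /eqP x0] u a c z V.
apply: (closed_op closed_safe) => //=; first by move=> g; rewrite hC.
rewrite app_ids; apply: (closed_op closed_safe) => //=; first by move=> g; rewrite fx.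
have := view_ops aff_id aff_id (Aff (1 / eps) 0 (- (1 / eps)) 0 0 0) aff_id aff_id V.
move: (fun k => _) => z1; rewrite !aff_app_id (surjective_pairing x.2) final_scaled x0 => V1.
apply: (closed_sure closed_safe) => //=.
  by case: V1 => _ _ -> _; rewrite pyes_opp mul0r normr0 mulr0 addr0 invr1.
apply: safe_fin; split=> //=.
by have [_ _ _] := view_setK (0, 0) V1.
Qed.

Hypothesis win : forall x, kgrun false o (PS0, (0, 0)) x ->
  exists2 y, kgrun true o (kgmid x) y & kgwin y.

(** Whatever the tosses of the first pass, [win] provides a winning run, which the prover plays in
    the second pass. *)
Lemma start_safe m p q y u a c z : safe (Conf (Start, m, p, q, y, u, a, c) 0 z).
Proof.
apply: (start closed_safe); apply: (@pass_all _ _ T) => //.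
  by move=> p' C x A bC hC H; apply: step_safe => //; exists true => c'; exact: (H true).
move=> p' C' x hC' /win[y' r' wy]; apply: (mid closed_safe) => //.
apply: pass_ex r' _ => // p2 C2 hC2; exact: final_safe.
Qed.

(** Losing the lottery leads back to [Start], which is safe again; this is what [honest_accepts]
    needs to iterate rounds. *)
Lemma lottery_weigh d : at_lottery d -> running d /\
  exists k qy qn, [/\ forall g, prog (st d) (tape_at w (hd d)) g = Weigh k qy qn, accepting qy,
    pyes (rg d k) = pyes (prize T, - prize T) &
    forall j, (j < 2)%N -> safe (Conf qn (hd d) (setreg (rg d) k (payload j)))].
Proof.
case: d => -[[[[[[[ph m] p] q] y] u] a] c] h z [/= -> -> Ez]; split=> //.
exists regA, (Acc, m, p, q, y, u, a, c), (Start, m, p, q, y, u, a, c).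
by split=> //; [rewrite Ez|move=> j _; exact: start_safe].
Qed.

End Completeness.
End Protocol.

(** * From a linear-space reduction to the verifier *)

Lemma cip_run (S : finType) (M : lstm S kgsym) w t :
  (cip (tm_run S kgsym M w t) <= (size w).+1)%N.
Proof.
elim: t => [//|t]; rewrite /tm_run iterS; move: (iter _ _ _) => C IH.
rewrite /tm_step; case: ifP => // _; case: mdelta => [[[[q' a] mi] mw] od] /=.
case: mi => //=; first exact: leq_trans (leq_pred _) IH.
exact: geq_minr.
Qed.

Theorem theorem8 (S : finType) (L : seq S -> Prop) :
  lin_space_reducible L LKG ->
  forall eps : rat, 0 < eps -> eps < 1 / 2 ->
  exists V : verifier S, verifies V L eps /\ perfect_completeness V L.
Proof.
case=> M [f [comp red]] eps eps0 eps1.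
(* The space bound at time 0 on the empty word already excludes [mc M = 0]. *)
have n_gt0 : (0 < mc M)%N.
  by have [_ /(_ 0%N)] := comp [::]; case: (mc M) => //; rewrite mul0n ltn0.
have bC w : bounded w (tm_init S kgsym M).
  by move=> t; rewrite /in_bounds; have [_ /(_ t) ->] := comp w; rewrite andbT; exact: cip_run.
have out w : exists2 T, halts_in w T (tm_init S kgsym M) &
    pmap id (outs w T (tm_init S kgsym M)) = f w.
  by have [[T [hT ET]] _] := comp w; exists T => //; rewrite -ET /tm_run outs_cout.
pose V := prog_verifier (Start, false, false, mq0 M, PS0, None, mblank M, false)
  (@accepting S M) (@rejecting S M) (prog eps).
have perfect : perfect_completeness V L.
  move=> w /red Lw; have [T hT ET] := out w.
  have win := (LKG_run (f w)).1 Lw; rewrite -ET in win.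
  have safe0 := start_safe n_gt0 eps0 (bC w) hT win.
  have pr0 := prize_gt0 M eps0 w T.
  have a0 : 0 < pyes (prize M eps w T, - prize M eps w T).
    by rewrite pyes_opp invr_gt0 (gtr0_norm pr0); lra.
  eexists; exact: honest_accepts (lottery_weigh n_gt0 eps0 (bC w) hT win) (msg0 M) a0 (pyes_le1 _)
    (safe0 _ _ _ _ _ _ _ _).
exists V; split=> //; split; first by apply: wf_prog_verifier; case=> -[[[[[[[]]]]]]].
split.
  move=> w /perfect[P HP]; exists P => d d0; have [t Ht] := HP d d0; exists t.
  by apply: le_trans Ht; lra.
move=> w nL P d d0; have [T hT ET] := out w.
have bad : exists2 x, kgrun false (pmap id (outs w T (tm_init S kgsym M))) (PS0, (0, 0)) x &
  forall y, kgrun true (pmap id (outs w T (tm_init S kgsym M))) (kgmid x) y -> ~~ kgwin y.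
  (* By excluded middle: if every first run had a winning answer, [LKG_run] would put [f w] in
     [LKG], hence [w] in [L]. *)
  apply: NNPP => nb; apply: nL; apply/red/LKG_run => x; rewrite -ET => rx.
  apply: NNPP => ny; apply: nb; exists x => // y ry; apply/negP => wy; apply: ny; by exists y.
have [v le_v sv] := starts_with_bound n_gt0 eps0 (bC w) hT bad.
have [t Ht] := sv false false (mq0 M) PS0 None (mblank M) false (fun=> (0, 0)).
exists t; apply: le_trans (Ht P [::]); lra.
Qed.
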